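(* Let $d,u\in\mathbb{N}_0$ with $d\ge u$, let $c_1,\ldots,c_d\in\mathbb{N}\setminus\{2\}$ with $c_1\ge3$ if $u\ge1$, and let $z_0,\ldots,z_d\in\mathbb{C}$ with $|z_j|<1$. With $c_0=1$, $c_{d+1}=0$, $\delta_i=\delta(c_i)+\delta(c_{i+1})$, $k_{-1}=0$, $$\sum_{\substack{a_0,\ldots,a_d\geq0\\ a_u\geq1}}t^{\star}(\{2\}^{a_0},c_1,\{2\}^{a_1},\ldots,c_d,\{2\}^{a_d})z_0^{2a_0}\cdots z_d^{2a_d}=z_u^2\cdot\frac{2}{\pi}\sum_{k_0\geq\cdots\geq k_d\geq1}\frac{1}{(2k_u-1)^2}\prod_{i=0}^{d}\frac{(-1)^{k_i\delta_i}(2k_i-1)^{\delta_i-1}}{(2k_i-1)^2-z_i^2}V_{k_{i-1},k_i}^{\#}(\{1\}^{c_i-3}).$$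
   Context: For an index $\boldsymbol{s}=(s_1,\ldots,s_r)$ of positive integers with $s_1>1$ (or empty), $t^{\star}(\boldsymbol{s})=\sum_{k_1\geq\cdots\geq k_r\geq1}\prod_{j=1}^r(2k_j-1)^{-s_j}$, $t^\star(\emptyset)=1$. $\{s\}^a$ denotes $s$ repeated $a$ times; for $a\le0$, $\{1\}^a$ is empty. $\triangle(k,m)=0$ if $k=m$, $1$ otherwise. For an index $\boldsymbol{s}=(s_1,\ldots,s_r)$ and $k,m\in\mathbb{N}_0$: if $\boldsymbol{s}\ne\emptyset$ and $k\ge m$, $V^{\#}_{k,m}(\boldsymbol{s})=\frac{2k-1}{2m-1}\sum_{k\geq l_1\geq\cdots\geq l_r\geq m}\frac{2^{\triangle(k,l_1)+\triangle(l_1,l_2)+\cdots+\triangle(l_r,m)}}{(2l_1-1)^{s_1}\cdots(2l_r-1)^{s_r}}$; otherwise $V^{\#}_{k,m}(\boldsymbol{s})=\left(2\cdot\frac{2k-1}{2m-1}\right)^{\triangle(k,m)}$. $\delta(0)=2$, $\delta(1)=1$, $\delta(c)=0$ for $c\ge3$. *)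

(* Defs.v *)
From Stdlib Require Import Reals List Arith.
From Coquelicot Require Import Coquelicot.
Open Scope R_scope.

(** odd number 2k-1 as a real (k may be 0, giving -1) *)
Definition odd_r (k : nat) : R := 2 * INR k - 1.

Definition tri (k m : nat) : nat := if Nat.eqb k m then 0%nat else 1%nat.

(** delta(0)=2, delta(1)=1, delta(c)=0 for c>=3 (delta(2) never used) *)
Definition delta (c : nat) : nat :=
  match c with 0 => 2 | 1 => 1 | _ => 0 end%nat.

Fixpoint tstar_trunc (s : list nat) (N : nat) : R :=
  match s with
  | nil => 1
  | s1 :: s' => sum_n_m (fun k => / (odd_r k) ^ s1 * tstar_trunc s' k) 1 N
  end.

(** t^star(s) as the limit of the (nondecreasing) truncations; t^star(nil) = 1 *)
Definition tstar (s : list nat) : R := real (Lim_seq (tstar_trunc s)).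

Fixpoint Wsum (s : list nat) (k m : nat) : R :=
  match s with
  | nil => 2 ^ (tri k m)
  | s1 :: s' => sum_n_m (fun l => 2 ^ (tri k l) * / (odd_r l) ^ s1 * Wsum s' l m) m k
  end.

Definition Vsharp (s : list nat) (k m : nat) : R :=
  match s with
  | nil => (2 * (odd_r k / odd_r m)) ^ (tri k m)
  | _ :: _ => if Nat.leb m k then odd_r k / odd_r m * Wsum s k m
              else (2 * (odd_r k / odd_r m)) ^ (tri k m)
  end.

(** {1}^a for a <= 0 is empty: here a = c - 3 with truncated subtraction *)
Definition ones (c : nat) : list nat := repeat 1%nat (c - 3).

Definition cext (d : nat) (c : nat -> nat) (i : nat) : nat :=
  if Nat.eqb i 0 then 1%nat else if Nat.eqb i (S d) then 0%nat else c i.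

Definition lhs_index (d : nat) (c : nat -> nat) (a : list nat) : list nat :=
  repeat 2%nat (nth 0 a 0%nat) ++
  flat_map (fun i => c i :: repeat 2%nat (nth i a 0%nat)) (seq 1 d).

Fixpoint boxsum (n N : nat) (F : list nat -> C) : C :=
  match n with
  | O => F nil
  | S n' => sum_n_m (fun a => boxsum n' N (fun l => F (a :: l))) 0 N
  end.

Fixpoint chainsum (n N : nat) (F : list nat -> C) : C :=
  match n with
  | O => F nil
  | S n' => sum_n_m (fun k => chainsum n' k (fun l => F (k :: l))) 1 N
  end.

Definition Cprod (l : list C) : C := fold_right Cmult (RtoC 1) l.

Definition lhs_trunc (d u : nat) (c : nat -> nat) (z : nat -> C) (N : nat) : C :=
  boxsum (S d) N (fun a =>
    if Nat.eqb (nth u a 0%nat) 0 then RtoC 0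
    else Cmult (RtoC (tstar (lhs_index d c a)))
         (Cprod (map (fun i => pow_n (z i) (2 * nth i a 0%nat)) (seq 0 (S d))))).

Definition rhs_factor (d : nat) (c : nat -> nat) (z : nat -> C) (ks : list nat) (i : nat) : C :=
  let ki := nth i ks 0%nat in
  let kprev := match i with O => 0%nat | S j => nth j ks 0%nat end in
  let di := (delta (cext d c i) + delta (cext d c (S i)))%nat in
  Cdiv (RtoC ((-1) ^ (ki * di) * powerRZ (odd_r ki) (Z.of_nat di - 1)
              * Vsharp (ones (cext d c i)) kprev ki))
       (Cminus (RtoC ((odd_r ki) ^ 2)) (Cmult (z i) (z i))).

Definition rhs_trunc (d u : nat) (c : nat -> nat) (z : nat -> C) (N : nat) : C :=
  Cmult (Cmult (Cmult (z u) (z u)) (RtoC (2 / PI)))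
  (chainsum (S d) N (fun ks =>
    Cmult (RtoC (/ (odd_r (nth u ks 0%nat)) ^ 2))
    (Cprod (map (rhs_factor d c z ks) (seq 0 (S d)))))).

(* Main.v *)
Require Import Defs.
From Stdlib Require Import Reals List Arith Lra Lia.
From Coquelicot Require Import Coquelicot.
Open Scope R_scope.

(** Let [L_c f n = sum_(m <= n) f m / (2m-1)^c], so that a truncated t-star sum is a product of
    operators [L_c] applied to the constant 1. The operator [L_2] is triangular with distinct
    eigenvalues [1/(2k-1)^2]; let [B] be its matrix of eigenvectors, normalised so that [B 1 = 1].
    In the basis [B], summing over a block [{2}^a] is a diagonal geometric series, producing the
    factors [(2k-1)^2 / ((2k-1)^2 - z^2)]. Since [L_c = L_2 D^(2-c)] with [D = diag (2k-1)], the other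
    [L_c] become [D^-2 K^(c-2)] with [K = B^-1 D^-1 B], and [K] has the entries
    [2^tri(k,m) (2k-1) / (2m-1)^2]: its positive powers are the [V#] of the statement and its inverse
    carries the signs of the case [c = 1]. This gives an exact identity for every truncation [n],
    with coefficients [B n k]. Finally [B n k] tends to [(4/pi) (-1)^(k-1) / (2k-1)], and two uses
    of Tannery's theorem let [n] and then the truncation of the exponents [a_i] go to infinity. *)

(** The exchanges of limits are delicate because the conjugated matrices are unbounded: the absolute
    row sums for c = 1 grow like log k, and every further factor would add a logarithm. The weight
    sqrt k avoids tracking these powers. For c different from 2, a conjugated operator maps O(sqrt
    k) to O(sqrt k), and for c >= 3 even to O(1/sqrt k). As the entries of B are O(1/k) uniformly in
    n, a vector of size O(1/sqrt k) gives the summable majorant k^(-3/2). This decay is what the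
    hypotheses provide: if u = 0, the condition a_0 >= 1 gives a factor 1/k^2 at the head of the
    chain; if u >= 1, the first matrix has c_1 >= 3.

    The shape of the right side is read off from the matrices. Each one carries a sign and a power
    in its row index and in its column index, so k_i collects delta(c_i) from one neighbour and
    delta(c_(i+1)) from the other. The conventions c_0 = 1 and k_(-1) = 0 make the factor belonging
    to k_0 reproduce, up to the constant 2/pi, the limit of the rows of B. *)

Lemma sum_R_S (a : nat -> R) (n m : nat) : (n <= S m)%nat ->
  sum_n_m a n (S m) = sum_n_m a n m + a (S m).
Proof. exact (sum_n_Sm a n m). Qed.

Lemma sum_R_first (a : nat -> R) (n m : nat) : (n <= m)%nat ->
  sum_n_m a n m = a n + sum_n_m a (S n) m.
Proof. exact (sum_Sn_m a n m). Qed.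

Lemma sum_R_empty (a : nat -> R) (n m : nat) : (m < n)%nat -> sum_n_m a n m = 0.
Proof. exact (sum_n_m_zero a n m). Qed.

Lemma sum_R_ext (a b : nat -> R) (n m : nat) :
  (forall k, (n <= k <= m)%nat -> a k = b k) -> sum_n_m a n m = sum_n_m b n m :> R.
Proof. exact (sum_n_m_ext_loc a b n m). Qed.

Lemma sum_R_plus (a b : nat -> R) (n m : nat) :
  sum_n_m (fun k => a k + b k) n m = sum_n_m a n m + sum_n_m b n m.
Proof. exact (sum_n_m_plus a b n m). Qed.

Lemma sum_R_mult_l (x : R) (a : nat -> R) (n m : nat) :
  sum_n_m (fun k => x * a k) n m = x * sum_n_m a n m.
Proof. exact (sum_n_m_mult_l (K := R_Ring) x a n m). Qed.

Lemma sum_n_m_triangle {G : AbelianMonoid} (f : nat -> nat -> G) (p n : nat) :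
  sum_n_m (fun k => sum_n_m (f k) p k) p n =
  sum_n_m (fun l => sum_n_m (fun k => f k l) l n) p n.
Proof.
  induction n as [|n IH].
  - destruct p as [|p].
    + rewrite !sum_n_n. reflexivity.
    + rewrite !sum_n_m_zero by lia. reflexivity.
  - destruct (le_lt_dec p (S n)) as [Hp|Hp].
    2:{ rewrite !sum_n_m_zero by lia. reflexivity. }
    rewrite !sum_n_Sm by exact Hp. rewrite IH, sum_n_n, plus_assoc. f_equal.
    rewrite <- sum_n_m_plus. apply sum_n_m_ext_loc. intros k Hk.
    rewrite sum_n_Sm by lia. reflexivity.
Qed.

Lemma odd_r_S (k : nat) : odd_r (S k) = odd_r k + 2.
Proof. unfold odd_r. rewrite S_INR. ring. Qed.

Lemma odd_r_ge (k : nat) : (1 <= k)%nat -> INR k <= odd_r k /\ 1 <= INR k.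
Proof. intros H. apply le_INR in H. simpl in H. unfold odd_r. lra. Qed.

Lemma odd_r_pos (k : nat) : (1 <= k)%nat -> 0 < odd_r k.
Proof. intros H. apply odd_r_ge in H. lra. Qed.

Lemma odd_r_neq0 (k : nat) : odd_r k <> 0.
Proof.
  destruct k; [unfold odd_r; simpl; lra|].
  apply Rgt_not_eq, odd_r_pos. lia.
Qed.

(** * The eigenbasis of the summation operator with weight [1/(2k-1)^2] *)

(** Partial Wallis product of (2j-1)^2 / ((2j-2) (2j)) for j from 2 to n. The value 0 at n = 0 makes
    row 0 of the matrix vanish, so that [mag_shift] also holds between rows 0 and 1. *)
Fixpoint lead (n : nat) : R :=
  match n with
  | O => 0
  | S O => 1
  | S m => lead m * (odd_r n ^ 2 / (odd_r n ^ 2 - 1))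
  end.

Fixpoint mag (n k : nat) : R :=
  match k with
  | O => lead n
  | S k' => mag n k' * ((INR n - INR k') / (INR n + INR k'))
  end.

(* Column k is the eigenvector of f |-> (n |-> sum_(m <= n) f m / (2m-1)^2) with
   eigenvalue (2k-1)^-2, normalised so that the rows sum to 1. In closed form
   mag n k = 4 ((2n-1)!!)^2 / (4^n (n-k)! (n+k-1)!). *)
Definition Bmat (n k : nat) : R := (-1) ^ S k * mag n k / odd_r k.

Lemma mag_O (k : nat) : mag 0 k = 0.
Proof. induction k as [|k IH]; simpl; [reflexivity|]. rewrite IH. ring. Qed.

Lemma mag_S (n k : nat) :
  (INR n + INR k) * mag n (S k) = (INR n - INR k) * mag n k.
Proof.
  destruct n as [|n].
  - rewrite !mag_O. ring.
  - change (mag (S n) (S k)) with (mag (S n) k * ((INR (S n) - INR k) / (INR (S n) + INR k))).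
    field. rewrite S_INR. pose proof (pos_INR n). pose proof (pos_INR k). lra.
Qed.

Lemma mag_1 (n : nat) : mag n 1 = lead n.
Proof.
  destruct n as [|n]; [apply mag_O|].
  change (mag (S n) 1) with (lead (S n) * ((INR (S n) - 0) / (INR (S n) + 0))).
  rewrite S_INR. field. pose proof (pos_INR n). lra.
Qed.

Lemma mag_gt (n k : nat) : (n < k)%nat -> mag n k = 0.
Proof.
  induction 1 as [|k H IH].
  - simpl. unfold Rdiv. rewrite Rminus_diag. ring.
  - simpl. rewrite IH. ring.
Qed.

Lemma Bmat_gt (n k : nat) : (n < k)%nat -> Bmat n k = 0.
Proof. intros H. unfold Bmat. rewrite mag_gt by exact H. unfold Rdiv. ring. Qed.

Lemma lead_S (n : nat) : (1 <= n)%nat ->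
  lead (S n) = lead n * (odd_r (S n) ^ 2 / (odd_r (S n) ^ 2 - 1)).
Proof. destruct n; [lia|reflexivity]. Qed.

Lemma mag_shift (n k : nat) : (1 <= k)%nat ->
  mag n k * odd_r (S n) ^ 2 = mag (S n) k * (odd_r (S n) ^ 2 - odd_r k ^ 2).
Proof.
  induction 1 as [|k Hk IH].
  - rewrite !mag_1. destruct n as [|n].
    + simpl lead. unfold odd_r. simpl. ring.
    + rewrite (lead_S (S n)) by lia.
      assert (odd_r (S (S n)) ^ 2 - 1 <> 0).
      { unfold odd_r. rewrite !S_INR. pose proof (pos_INR n). nra. }
      replace (odd_r 1 ^ 2) with 1 by (unfold odd_r; simpl; ring). field. assumption.
  - change (mag n (S k)) with (mag n k * ((INR n - INR k) / (INR n + INR k))).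
    change (mag (S n) (S k)) with (mag (S n) k * ((INR (S n) - INR k) / (INR (S n) + INR k))).
    assert (Hk1 : 1 <= INR k) by (apply (le_INR 1); exact Hk). pose proof (pos_INR n) as Hn.
    replace (mag n k * ((INR n - INR k) / (INR n + INR k)) * odd_r (S n) ^ 2)
      with (mag n k * odd_r (S n) ^ 2 * ((INR n - INR k) / (INR n + INR k))) by (field; lra).
    rewrite IH. unfold odd_r. rewrite !S_INR. field. lra.
Qed.

(** This is the eigenvector equation of column k, differenced between rows n and n+1. The sum has
    disappeared, so the product formula for [mag] suffices. *)
Lemma Bmat_shift (n k : nat) : (1 <= k)%nat ->
  / odd_r (S n) ^ 2 * Bmat (S n) k = (Bmat (S n) k - Bmat n k) * / odd_r k ^ 2.
Proof.
  intros Hk. pose proof (mag_shift n k Hk) as H.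
  pose proof (odd_r_neq0 k). pose proof (odd_r_neq0 (S n)).
  assert (E : mag n k = mag (S n) k * (odd_r (S n) ^ 2 - odd_r k ^ 2) / odd_r (S n) ^ 2).
  { rewrite <- H. field. assumption. }
  unfold Bmat. rewrite E. field. split; assumption.
Qed.

(** Multiplied by 2k-1 the entries are [mag] up to sign, and the relation is the ratio [mag_S]
    rewritten. It is the one-step difference in m of both [sum_Bmat_odd_tri] and
    [sum_Bmat_odd_sqr_alt_tri]. *)
Lemma Bmat_neighbours (n m : nat) :
  odd_r n * (Bmat n m * odd_r m + Bmat n (S m) * odd_r (S m)) =
  Bmat n m * odd_r m ^ 2 - Bmat n (S m) * odd_r (S m) ^ 2.
Proof.
  pose proof (mag_S n m) as H. pose proof (odd_r_neq0 m). pose proof (odd_r_neq0 (S m)).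
  unfold Bmat.
  transitivity ((-1) ^ S m * (odd_r n * (mag n m - mag n (S m)))).
  { simpl pow. field. split; assumption. }
  transitivity ((-1) ^ S m * (odd_r m * mag n m + odd_r (S m) * mag n (S m))).
  2:{ simpl pow. field. split; assumption. }
  f_equal. unfold odd_r in *. rewrite S_INR in *. nra.
Qed.

(** The summand is hypergeometric in k with ratio given by [mag_S], and the right side is its
    antidifference. The factor n - K makes the full row sum vanish for n >= 2, which keeps the row
    sums of [Bmat] constant. *)
Lemma sum_Bmat_odd_sqr (n K : nat) : (1 <= n)%nat ->
  (INR n - 1) * sum_n_m (fun k => Bmat n k * odd_r k ^ 2) 1 K =
  (-1) ^ S K * INR K * (INR n - INR K) * mag n K.
Proof.
  intros Hn. induction K as [|K IH].
  - rewrite sum_R_empty by lia. simpl. ring.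
  - rewrite sum_R_S by lia. rewrite Rmult_plus_distr_l, IH.
    pose proof (mag_S n K) as H. pose proof (odd_r_neq0 (S K)).
    unfold Bmat.
    replace ((-1) ^ S (S K) * mag n (S K) / odd_r (S K) * odd_r (S K) ^ 2)
      with ((-1) ^ S (S K) * mag n (S K) * odd_r (S K)) by (field; assumption).
    replace ((-1) ^ S K * INR K * (INR n - INR K) * mag n K)
      with ((-1) ^ S K * INR K * ((INR n + INR K) * mag n (S K))) by (rewrite H; ring).
    unfold odd_r. rewrite !S_INR. simpl pow. ring.
Qed.

Lemma sum_Bmat_stable (n M : nat) : (n <= M)%nat ->
  sum_n_m (Bmat n) 1 M = sum_n_m (Bmat n) 1 n :> R.
Proof.
  induction 1 as [|M H IH]; [reflexivity|].
  rewrite sum_R_S, IH, Bmat_gt by lia. ring.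
Qed.

Lemma sum_Bmat (n M : nat) : (1 <= n <= M)%nat -> sum_n_m (Bmat n) 1 M = 1.
Proof.
  intros [Hn HM]. rewrite sum_Bmat_stable by exact HM. clear M HM.
  induction Hn as [|n Hn IH].
  - rewrite sum_n_n. unfold Bmat. rewrite mag_1. unfold odd_r. simpl. field.
  - rewrite <- IH, <- (sum_Bmat_stable n (S n)) by lia.
    pose proof (sum_Bmat_odd_sqr (S n) (S n) ltac:(lia)) as H.
    rewrite Rminus_diag, Rmult_0_r, Rmult_0_l, S_INR in H.
    assert (Hn1 : 1 <= INR n) by (apply (le_INR 1); exact Hn).
    apply Rmult_integral in H. destruct H as [H|H]; [lra|].
    enough (sum_n_m (fun k => Bmat (S n) k + -1 * Bmat n k) 1 (S n) = 0 :> R) as E.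
    { rewrite sum_R_plus, sum_R_mult_l in E. lra. }
    (* By [Bmat_shift], rows n+1 and n differ by B(n+1,k) (2k-1)^2 / (2n+1)^2, and [H] says that
       these terms sum to 0. *)
    transitivity (/ odd_r (S n) ^ 2 * sum_n_m (fun k => Bmat (S n) k * odd_r k ^ 2) 1 (S n)).
    2:{ rewrite H. ring. }
    rewrite <- sum_R_mult_l. apply sum_R_ext. intros k [Hk _].
    pose proof (Bmat_shift n k Hk) as Hs. pose proof (odd_r_neq0 k).
    replace (Bmat (S n) k + -1 * Bmat n k)
      with ((Bmat (S n) k - Bmat n k) * / odd_r k ^ 2 * odd_r k ^ 2) by (field; assumption).
    rewrite <- Hs. ring.
Qed.

(** * Size and limit of the eigenvectors *)

Lemma lead_nonneg (n : nat) : 0 <= lead n /\ lead n <= lead (S n).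
Proof.
  induction n as [|n IH]; [simpl; lra|].
  split; [lra|]. rewrite (lead_S (S n)) by lia.
  assert (H : 1 < odd_r (S (S n)) ^ 2).
  { unfold odd_r. rewrite !S_INR. pose proof (pos_INR n). nra. }
  rewrite <- (Rmult_1_r (lead (S n))) at 1. apply Rmult_le_compat_l; [lra|].
  apply Rle_div_r; lra.
Qed.

Lemma mag_decr (n k : nat) : 0 <= mag n k /\ mag n (S k) <= mag n k.
Proof.
  assert (H0 : forall k, 0 <= mag n k).
  { clear k. intros k. induction k as [|k IH]; [apply lead_nonneg|].
    destruct (le_lt_dec (S k) n) as [H|H].
    - simpl. apply Rmult_le_pos; [exact IH|]. apply le_INR in H. rewrite S_INR in H.
      pose proof (pos_INR k). apply Rdiv_le_0_compat; lra.
    - rewrite mag_gt by exact H. lra. }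
  split; [apply H0|].
  destruct (le_lt_dec (S k) n) as [H|H].
  - pose proof (mag_S n k) as E. pose proof (H0 k). pose proof (H0 (S k)).
    apply le_INR in H. rewrite S_INR in H. pose proof (pos_INR k). nra.
  - rewrite mag_gt by lia. apply H0.
Qed.

Lemma mag_le_lead (n k : nat) : mag n k <= lead n.
Proof.
  induction k as [|k IH]; [apply Rle_refl|].
  pose proof (mag_decr n k). lra.
Qed.

Lemma Bmat_pair (n k : nat) : (1 <= k)%nat ->
  0 <= (-1) ^ S k * (Bmat n k + Bmat n (S k)).
Proof.
  intros Hk. pose proof (odd_r_pos k Hk) as H1. pose proof (odd_r_S k) as H2.
  unfold Bmat.
  replace ((-1) ^ S k * ((-1) ^ S k * mag n k / odd_r k + (-1) ^ S (S k) * mag n (S k) / odd_r (S k)))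
    with (((-1) ^ S k * (-1) ^ S k) * (mag n k / odd_r k - mag n (S k) / odd_r (S k)))
    by (simpl pow; field; split; apply odd_r_neq0).
  rewrite <- Rpow_mult_distr. replace (-1 * -1) with 1 by ring. rewrite pow1, Rmult_1_l.
  pose proof (mag_decr n k) as Hm. pose proof (mag_decr n (S k)) as Hm'.
  apply -> Rminus_le_0. unfold Rdiv. apply Rmult_le_compat; try lra.
  - apply Rlt_le, Rinv_0_lt_compat. lra.
  - apply Rinv_le_contravar; lra.
Qed.

(** By [Bmat_pair], adding two consecutive terms after an even number of them never decreases the
    sum, and the partial sums end at the full row sum 1. *)
Lemma sum_Bmat_even (n K : nat) : (1 <= n)%nat -> sum_n_m (Bmat n) 1 (2 * K) <= 1.
Proof.
  intros Hn.
  assert (H : forall j, sum_n_m (Bmat n) 1 (2 * K) <= sum_n_m (Bmat n) 1 (2 * (K + j))).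
  { induction j as [|j IH]; [rewrite Nat.add_0_r; apply Rle_refl|].
    replace (2 * (K + S j))%nat with (S (S (2 * (K + j)))) by lia.
    rewrite !sum_R_S by lia.
    pose proof (Bmat_pair n (S (2 * (K + j))) ltac:(lia)) as Hp.
    replace (S (S (2 * (K + j))))%nat with (2 * S (K + j))%nat in Hp at 1 by lia.
    rewrite pow_1_even in Hp. lra. }
  rewrite (H n). rewrite (sum_Bmat n) by lia. apply Rle_refl.
Qed.

Lemma sum_Bmat_odd (n K : nat) : (1 <= n)%nat -> 1 <= sum_n_m (Bmat n) 1 (S (2 * K)).
Proof.
  intros Hn.
  assert (H : forall j, sum_n_m (Bmat n) 1 (S (2 * (K + j))) <= sum_n_m (Bmat n) 1 (S (2 * K))).
  { induction j as [|j IH]; [rewrite Nat.add_0_r; apply Rle_refl|].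
    replace (S (2 * (K + S j)))%nat with (S (S (S (2 * (K + j))))) by lia.
    rewrite sum_R_S, sum_R_S by lia.
    pose proof (Bmat_pair n (S (S (2 * (K + j)))) ltac:(lia)) as Hp.
    replace (S (S (S (2 * (K + j)))))%nat with (S (2 * S (K + j)))%nat in Hp at 1 by lia.
    rewrite pow_1_odd in Hp. lra. }
  rewrite <- (H n). rewrite (sum_Bmat n) by lia. apply Rle_refl.
Qed.

Lemma lead_bound (n : nat) : lead n <= 3 / 2.
Proof.
  destruct n as [|n]; [simpl; lra|].
  (* The first two terms already bound [lead]: lead - mag 2 / 3 <= 1 together with mag 2 <= lead
     gives 2/3 lead <= 1. *)
  pose proof (sum_Bmat_even (S n) 1 ltac:(lia)) as H.
  change (2 * 1)%nat with 2%nat in H. rewrite sum_R_S, sum_n_n in H by lia.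
  unfold Bmat in H. rewrite mag_1 in H. pose proof (mag_le_lead (S n) 2) as H2.
  replace (odd_r 1) with 1 in H by (unfold odd_r; simpl; ring).
  replace (odd_r 2) with 3 in H by (unfold odd_r; simpl; ring).
  simpl pow in H. lra.
Qed.

Lemma Bmat_bound (n k : nat) : (1 <= k)%nat -> Rabs (Bmat n k) <= 2 / INR k.
Proof.
  intros Hk. destruct (odd_r_ge k Hk) as [H1 H2].
  unfold Bmat, Rdiv. rewrite !Rabs_mult, pow_1_abs, Rmult_1_l.
  pose proof (mag_decr n k). pose proof (mag_le_lead n k). pose proof (lead_bound n).
  rewrite (Rabs_pos_eq (mag n k)) by lra.
  rewrite Rabs_pos_eq by (apply Rlt_le, Rinv_0_lt_compat; lra).
  apply Rmult_le_compat; try lra.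
  - apply Rlt_le, Rinv_0_lt_compat; lra.
  - apply Rinv_le_contravar; lra.
Qed.

Lemma is_lim_seq_ratio (k : nat) :
  is_lim_seq (fun n => (INR n - INR k) / (INR n + INR k)) 1.
Proof.
  apply is_lim_seq_ext_loc with (fun n => 1 - 2 * INR k * / (INR n + INR k)).
  { exists 1%nat. intros n Hn. apply (le_INR 1) in Hn. simpl in Hn. pose proof (pos_INR k). field. lra. }
  replace (Finite 1) with (Finite (1 - 2 * INR k * 0)) by (f_equal; ring).
  apply is_lim_seq_minus'; [apply is_lim_seq_const|].
  apply is_lim_seq_mult'; [apply is_lim_seq_const|].
  change (Finite 0) with (Rbar_inv p_infty).
  apply is_lim_seq_inv; [|discriminate].
  eapply is_lim_seq_plus; [apply is_lim_seq_INR|apply is_lim_seq_const|]. reflexivity.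
Qed.

Lemma is_lim_seq_mag (lam : R) (k : nat) :
  is_lim_seq lead lam -> is_lim_seq (fun n => mag n k) lam.
Proof.
  intros H. induction k as [|k IH]; [exact H|].
  simpl. replace (Finite lam) with (Finite (lam * 1)) by (f_equal; ring).
  apply is_lim_seq_mult'; [exact IH|apply is_lim_seq_ratio].
Qed.

Definition alt (K : nat) : R := sum_n_m (fun k => (-1) ^ S k / odd_r k) 1 K.

Lemma alt_S (K : nat) : alt (S K) = sum_f_R0 (tg_alt PI_tg) K.
Proof.
  induction K as [|K IH].
  - unfold alt. rewrite sum_n_n. unfold tg_alt, PI_tg, odd_r. simpl. field.
  - unfold alt in *. rewrite sum_R_S by lia. rewrite IH. simpl sum_f_R0. f_equal.
    unfold tg_alt, PI_tg, odd_r. rewrite plus_INR, mult_INR, !S_INR. simpl. field.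
    pose proof (pos_INR K). lra.
Qed.

Lemma is_lim_seq_sum_Bmat (lam : R) (K : nat) :
  is_lim_seq lead lam -> is_lim_seq (fun n => sum_n_m (Bmat n) 1 K) (lam * alt K).
Proof.
  intros H. unfold alt. induction K as [|K IH].
  - apply is_lim_seq_ext with (fun _ => 0).
    { intros n. rewrite sum_R_empty by lia. reflexivity. }
    rewrite sum_R_empty by lia. rewrite Rmult_0_r. apply is_lim_seq_const.
  - rewrite sum_R_S by lia. rewrite Rmult_plus_distr_l.
    apply is_lim_seq_ext with (fun n => sum_n_m (Bmat n) 1 K + Bmat n (S K)).
    { intros n. rewrite sum_R_S by lia. reflexivity. }
    apply is_lim_seq_plus'; [exact IH|]. unfold Bmat.
    apply is_lim_seq_ext with (fun n => mag n (S K) * ((-1) ^ S (S K) / odd_r (S K))).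
    { intros n. unfold Rdiv. ring. }
    apply is_lim_seq_mult'; [apply is_lim_seq_mag, H|apply is_lim_seq_const].
Qed.

(* The partial sums of row n of Bmat alternate around 1, hence those of lam * (1 - 1/3 + 1/5 - ...)
   alternate around 1 as well, and lam is read off from Leibniz' series. *)
Lemma is_lim_seq_lead : is_lim_seq lead (4 / PI).
Proof.
  assert (Hex : ex_finite_lim_seq lead).
  { apply ex_finite_lim_seq_incr with (3 / 2); [intros n; apply lead_nonneg|apply lead_bound]. }
  destruct Hex as [lam Hlam].
  assert (H0 : 0 <= lam).
  { apply (is_lim_seq_le (fun _ => 0) lead 0 lam); [intros n; apply lead_nonneg|apply is_lim_seq_const|exact Hlam]. }
  assert (Hev : forall K, lam * alt (2 * K) <= 1).
  { intros K. refine (is_lim_seq_le_loc _ _ (lam * alt (2 * K)) 1 _ (is_lim_seq_sum_Bmat lam (2 * K) Hlam) (is_lim_seq_const 1)).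
    exists 1%nat. intros n Hn. apply sum_Bmat_even, Hn. }
  assert (Hod : forall K, 1 <= lam * alt (S (2 * K))).
  { intros K. refine (is_lim_seq_le_loc _ _ 1 (lam * alt (S (2 * K))) _ (is_lim_seq_const 1) (is_lim_seq_sum_Bmat lam (S (2 * K)) Hlam)).
    exists 1%nat. intros n Hn. apply sum_Bmat_odd, Hn. }
  (* Both 1 and lam * PI/4 lie between lam * alt (2K) and lam * alt (2K+1), an interval of length at
     most lam / K. *)
  assert (Hd : forall K, (1 <= K)%nat -> Rabs (lam * (PI / 4) - 1) <= lam / INR K).
  { intros K HK. specialize (Hev K). specialize (Hod K).
    assert (HPI1 : alt (2 * K) <= PI / 4).
    { destruct K as [|K]; [lia|]. replace (2 * S K)%nat with (S (S (2 * K))) by lia.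
      rewrite alt_S. apply PI_ineq. }
    assert (HPI2 : PI / 4 <= alt (S (2 * K))) by (rewrite alt_S; apply PI_ineq).
    assert (Hdiff : alt (S (2 * K)) <= alt (2 * K) + / INR K).
    { unfold alt. rewrite sum_R_S by lia. apply Rplus_le_compat_l.
      replace (S (S (2 * K))) with (2 * S K)%nat by lia. rewrite pow_1_even.
      unfold Rdiv. rewrite Rmult_1_l. apply (le_INR 1) in HK. simpl in HK. apply Rinv_le_contravar.
      - lra.
      - unfold odd_r. rewrite S_INR, mult_INR. simpl INR. lra. }
    unfold Rdiv. apply Rabs_le. split; nra. }
  assert (E : lam * (PI / 4) - 1 = 0).
  { destruct (Req_dec (lam * (PI / 4) - 1) 0) as [E|E]; [exact E|exfalso].
    apply Rabs_pos_lt in E.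
    destruct (nfloor_ex (lam / Rabs (lam * (PI / 4) - 1))) as [K [_ HK]].
    { apply Rdiv_le_0_compat; lra. }
    assert (HS : 0 < INR (S K)) by (apply lt_0_INR; lia).
    specialize (Hd (S K) ltac:(lia)).
    apply (Rle_div_r _ _ _ HS) in Hd.
    rewrite <- S_INR in HK. apply (Rlt_div_l _ _ _ E) in HK. lra. }
  replace (4 / PI) with lam; [exact Hlam|].
  pose proof PI_RGT_0. apply Rmult_eq_reg_r with (PI / 4); [|lra].
  replace (4 / PI * (PI / 4)) with 1 by (field; lra). lra.
Qed.

Definition beta (k : nat) : R := 4 / PI * (-1) ^ S k / odd_r k.

Lemma is_lim_seq_Bmat (k : nat) : is_lim_seq (fun n => Bmat n k) (beta k).
Proof.
  unfold beta, Bmat.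
  apply is_lim_seq_ext with (fun n => mag n k * ((-1) ^ S k / odd_r k)).
  { intros n. unfold Rdiv. ring. }
  replace (4 / PI * (-1) ^ S k / odd_r k) with (4 / PI * ((-1) ^ S k / odd_r k)) by (unfold Rdiv; ring).
  apply is_lim_seq_mult'; [apply is_lim_seq_mag, is_lim_seq_lead|apply is_lim_seq_const].
Qed.

(** * Conjugating the summation operators by the eigenbasis *)

Lemma sum_tri (f : nat -> R) (m n : nat) : (m <= n)%nat ->
  sum_n_m (fun k => f k * 2 ^ tri k m) m n = 2 * sum_n_m f m n - f m :> R.
Proof.
  intros H. rewrite (sum_R_first f), sum_R_first by exact H.
  rewrite (sum_R_ext _ (fun k => 2 * f k) (S m) n).
  - rewrite (sum_R_mult_l 2 f). unfold tri. rewrite Nat.eqb_refl, pow_O. ring.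
  - intros k Hk. unfold tri. replace (Nat.eqb k m) with false; [simpl; ring|].
    symmetry. apply Nat.eqb_neq. lia.
Qed.

(** This is D^-1 B = B K, with the column factor (2m-1)^-2 of K moved to the right. The induction
    goes down from m = n+1, where both sides vanish, with [Bmat_neighbours] as its step. *)
Lemma sum_Bmat_odd_tri (n m : nat) : (1 <= n)%nat ->
  sum_n_m (fun k => Bmat n k * odd_r k * 2 ^ tri k m) m n =
  / odd_r n * Bmat n m * odd_r m ^ 2 :> R.
Proof.
  intros Hn. pose proof (odd_r_neq0 n) as H0.
  assert (H : forall j m, (S n = m + j)%nat ->
    odd_r n * (2 * sum_n_m (fun k => Bmat n k * odd_r k) m n - Bmat n m * odd_r m) =
    Bmat n m * odd_r m ^ 2).
  { induction j as [|j IH]; intros p Hp.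
    - rewrite sum_R_empty, Bmat_gt by lia. ring.
    - specialize (IH (S p) ltac:(lia)). rewrite sum_R_first by lia.
      pose proof (Bmat_neighbours n p). lra. }
  destruct (le_lt_dec m n) as [Hm|Hm].
  - rewrite (sum_tri (fun k => Bmat n k * odd_r k)) by exact Hm.
    apply Rmult_eq_reg_l with (odd_r n); [|exact H0].
    rewrite (H (S n - m)%nat m) by lia. field. exact H0.
  - rewrite sum_R_empty, Bmat_gt by exact Hm. ring.
Qed.

(** The inverse relation D B = B K^-1: the entries of K^-1 are (-1)^(k+m) 2^tri(k,m) (2k-1)^2 /
    (2m-1). The downward induction is the same, and the alternating sign flips the tail at each
    step. *)
Lemma sum_Bmat_odd_sqr_alt_tri (n m : nat) :
  sum_n_m (fun k => Bmat n k * odd_r k ^ 2 * (-1) ^ (k + m) * 2 ^ tri k m) m n =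
  odd_r n * Bmat n m * odd_r m :> R.
Proof.
  assert (H : forall j m, (S n = m + j)%nat ->
    2 * sum_n_m (fun k => Bmat n k * odd_r k ^ 2 * (-1) ^ (k + m)) m n
      - Bmat n m * odd_r m ^ 2 = odd_r n * Bmat n m * odd_r m).
  { induction j as [|j IH]; intros p Hp.
    - rewrite sum_R_empty, Bmat_gt by lia. ring.
    - specialize (IH (S p) ltac:(lia)). rewrite sum_R_first by lia.
      rewrite (sum_R_ext _ (fun k => -1 * (Bmat n k * odd_r k ^ 2 * (-1) ^ (k + S p))) (S p) n).
      + rewrite sum_R_mult_l. replace (p + p)%nat with (2 * p)%nat by lia. rewrite pow_1_even.
        pose proof (Bmat_neighbours n p). lra.
      + intros k _. rewrite Nat.add_succ_r. simpl. ring. }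
  destruct (le_lt_dec m n) as [Hm|Hm].
  - rewrite (sum_tri (fun k => Bmat n k * odd_r k ^ 2 * (-1) ^ (k + m))) by exact Hm.
    rewrite <- (H (S n - m)%nat m) by lia.
    replace (m + m)%nat with (2 * m)%nat by lia. rewrite pow_1_even. ring.
  - rewrite sum_R_empty, Bmat_gt by exact Hm. ring.
Qed.

(** This is D^-(e+1) B = B K^(e+1): every entry 1 of the index inserts one more factor K. After
    exchanging the sums, the outer factor is absorbed by [sum_Bmat_odd_tri]. *)
Lemma sum_Bmat_Wsum (e n m : nat) : (1 <= n)%nat ->
  sum_n_m (fun k => Bmat n k * odd_r k * Wsum (repeat 1%nat e) k m) m n =
  / odd_r n ^ S e * Bmat n m * odd_r m ^ 2 :> R.
Proof.
  intros Hn. induction e as [|e IH].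
  - simpl Wsum. rewrite sum_Bmat_odd_tri by exact Hn. rewrite pow_1. reflexivity.
  - transitivity (sum_n_m (fun k => sum_n_m (fun l =>
      Bmat n k * odd_r k * (2 ^ tri k l * / odd_r l ^ 1 * Wsum (repeat 1%nat e) l m)) m k) m n).
    { apply sum_R_ext. intros k _. simpl Wsum. rewrite sum_R_mult_l. reflexivity. }
    rewrite sum_n_m_triangle.
    transitivity (/ odd_r n * sum_n_m (fun k => Bmat n k * odd_r k * Wsum (repeat 1%nat e) k m) m n).
    2:{ rewrite IH. simpl pow. pose proof (odd_r_neq0 n). field. split; [|assumption].
        apply pow_nonzero; assumption. }
    rewrite <- sum_R_mult_l. apply sum_R_ext. intros l _.
    transitivity (/ odd_r l * Wsum (repeat 1%nat e) l m *
                  sum_n_m (fun k => Bmat n k * odd_r k * 2 ^ tri k l) l n).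
    { rewrite <- sum_R_mult_l. apply sum_R_ext. intros k _. rewrite pow_1. ring. }
    rewrite sum_Bmat_odd_tri by exact Hn. field. split; apply odd_r_neq0.
Qed.

Lemma Vsharp_Wsum (s : list nat) (k m : nat) : (m <= k)%nat ->
  Vsharp s k m = odd_r k / odd_r m * Wsum s k m.
Proof.
  intros H. destruct s as [|a s]; simpl Vsharp.
  - simpl Wsum. unfold tri. destruct (Nat.eqb_spec k m) as [->|].
    + simpl. field. apply odd_r_neq0.
    + simpl. field. apply odd_r_neq0.
  - apply Nat.leb_le in H. rewrite H. reflexivity.
Qed.

(* The matrix of f |-> (n |-> sum_(m <= n) f m / (2m-1)^c) in the basis Bmat. *)
Definition Mmat (c k m : nat) : R :=
  if Nat.eqb c 2 then (if Nat.eqb k m then / odd_r k ^ 2 else 0)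
  else (-1) ^ (k * delta c) * odd_r k ^ delta c * / odd_r k ^ 2 *
       ((-1) ^ (m * delta c) * odd_r m ^ delta c * / odd_r m * Vsharp (ones c) k m).

(** Here D^2 M_c plays the role of K^(c-2): the identity for c = 2, the inverse of K for c = 1, and
    a positive power for c >= 3. A factor D^-2 is kept in front so that [Bmat_shift] can be applied
    next. *)
Lemma Bmat_mul_inv_pow (c n m : nat) : (1 <= c)%nat -> (1 <= n)%nat ->
  / odd_r n ^ c * Bmat n m =
  / odd_r n ^ 2 * sum_n_m (fun k => Bmat n k * (odd_r k ^ 2 * Mmat c k m)) m n.
Proof.
  intros Hc Hn. pose proof (odd_r_neq0 n) as Hn0. pose proof (odd_r_neq0 m) as Hm0.
  destruct (Nat.eqb_spec c 2) as [->|Hc2].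
  { f_equal. destruct (le_lt_dec m n) as [Hm|Hm].
    2:{ rewrite sum_R_empty, Bmat_gt by exact Hm. reflexivity. }
    rewrite sum_R_first by exact Hm.
    rewrite (sum_R_ext _ (fun k => 0 * 0) (S m) n).
    - rewrite sum_R_mult_l. unfold Mmat. simpl Nat.eqb. rewrite Nat.eqb_refl. field. exact Hm0.
    - intros k Hk. unfold Mmat. simpl Nat.eqb.
      replace (Nat.eqb k m) with false; [ring|]. symmetry. apply Nat.eqb_neq. lia. }
  assert (HM : forall k, Mmat c k m = (-1) ^ (k * delta c) * odd_r k ^ delta c * / odd_r k ^ 2 *
       ((-1) ^ (m * delta c) * odd_r m ^ delta c * / odd_r m * Vsharp (ones c) k m)).
  { intros k. unfold Mmat. apply Nat.eqb_neq in Hc2. rewrite Hc2. reflexivity. }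
  assert (Hcc : c = 1%nat \/ exists e, c = S (S (S e))).
  { destruct c as [|[|[|e]]]; [lia|now left|lia|right; now exists e]. }
  destruct Hcc as [->|[e ->]].
  - transitivity (/ odd_r n ^ 2 * (/ odd_r m *
      sum_n_m (fun k => Bmat n k * odd_r k ^ 2 * (-1) ^ (k + m) * 2 ^ tri k m) m n)).
    + rewrite sum_Bmat_odd_sqr_alt_tri. field. split; assumption.
    + f_equal. rewrite <- sum_R_mult_l. apply sum_R_ext. intros k Hk.
      rewrite HM, Vsharp_Wsum by lia. simpl Wsum. simpl delta. rewrite !Nat.mul_1_r, !pow_1, pow_add.
      field. split; apply odd_r_neq0.
  - transitivity (/ odd_r n ^ 2 * (/ odd_r m ^ 2 *
      sum_n_m (fun k => Bmat n k * odd_r k * Wsum (repeat 1%nat e) k m) m n)).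
    + rewrite sum_Bmat_Wsum by exact Hn. simpl pow. field. repeat split; try assumption.
      apply pow_nonzero, Hn0.
    + f_equal. rewrite <- sum_R_mult_l. apply sum_R_ext. intros k Hk.
      rewrite HM, Vsharp_Wsum by lia. unfold ones. replace (S (S (S e)) - 3)%nat with e by lia.
      simpl delta. rewrite !Nat.mul_0_r. simpl. field. split; [exact Hm0|apply odd_r_neq0].
Qed.

(** The relation L_c B = B M_c in column m. Passing to row n+1 adds one term on the left, and
    [Bmat_mul_inv_pow] followed by [Bmat_shift] turns it into the difference of rows n+1 and n of B,
    applied to M_c. *)
Lemma sum_Bmat_column (c n m : nat) : (1 <= c)%nat -> (1 <= m)%nat ->
  sum_n_m (fun j => / odd_r j ^ c * Bmat j m) m n =
  sum_n_m (fun k => Bmat n k * Mmat c k m) m n :> R.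
Proof.
  intros Hc Hm. induction n as [|n IH].
  - rewrite !sum_R_empty by lia. reflexivity.
  - destruct (le_lt_dec m (S n)) as [H|H].
    2:{ rewrite !sum_R_empty by lia. reflexivity. }
    rewrite (sum_R_S (fun j => / odd_r j ^ c * Bmat j m)) by exact H. rewrite IH.
    transitivity (sum_n_m (fun k => Bmat n k * Mmat c k m) m (S n) +
       sum_n_m (fun k => (Bmat (S n) k - Bmat n k) * Mmat c k m) m (S n)).
    + apply (f_equal2 Rplus).
      * rewrite sum_R_S by exact H. rewrite (Bmat_gt n (S n)) by lia. rewrite Rmult_0_l, Rplus_0_r. reflexivity.
      * rewrite (Bmat_mul_inv_pow c (S n)) by lia. rewrite <- sum_R_mult_l.
        apply sum_R_ext. intros k Hk. pose proof (odd_r_neq0 k).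
        transitivity (/ odd_r (S n) ^ 2 * Bmat (S n) k * (odd_r k ^ 2 * Mmat c k m)); [ring|].
        rewrite Bmat_shift by lia. field. assumption.
    + rewrite <- sum_R_plus. apply sum_R_ext. intros k _. ring.
Qed.

(** Coordinates in the eigenbasis of the truncated star sums of s. The empty index gives the
    all-ones vector because B 1 = 1, and each entry c contributes the matrix M_c. *)
Fixpoint phi (s : list nat) (k : nat) : R :=
  match s with
  | nil => 1
  | c :: s' => sum_n_m (fun m => Mmat c k m * phi s' m) 1 k
  end.

Lemma tstar_trunc_phi (s : list nat) (n : nat) :
  (forall c, In c s -> (1 <= c)%nat) -> (1 <= n)%nat ->
  tstar_trunc s n = sum_n_m (fun k => Bmat n k * phi s k) 1 n.
Proof.
  revert n. induction s as [|c s IH]; intros n Hs Hn.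
  - simpl. rewrite (sum_R_ext _ (Bmat n)) by (intros k _; simpl; ring).
    symmetry. apply sum_Bmat. lia.
  - simpl tstar_trunc.
    transitivity (sum_n_m (fun j => sum_n_m (fun m => / odd_r j ^ c * Bmat j m * phi s m) 1 j) 1 n).
    { apply sum_R_ext. intros j Hj. rewrite IH; [|intros; apply Hs; now right|lia].
      rewrite <- sum_R_mult_l. apply sum_R_ext. intros m _. ring. }
    transitivity (sum_n_m (fun k => sum_n_m (fun m => Bmat n k * Mmat c k m * phi s m) 1 k) 1 n).
    2:{ apply sum_R_ext. intros k _. simpl phi. rewrite <- sum_R_mult_l.
        apply sum_R_ext. intros m _. ring. }
    rewrite !sum_n_m_triangle. apply sum_R_ext. intros m Hm.
    transitivity (phi s m * sum_n_m (fun j => / odd_r j ^ c * Bmat j m) m n).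
    { rewrite <- sum_R_mult_l. apply sum_R_ext. intros; ring. }
    rewrite sum_Bmat_column; [|apply Hs; now left|lia].
    rewrite <- sum_R_mult_l. apply sum_R_ext. intros; ring.
Qed.

(** * Growth of the conjugated operators *)

Lemma sum_R_le (a b : nat -> R) (n m : nat) :
  (forall k, (n <= k <= m)%nat -> a k <= b k) -> sum_n_m a n m <= sum_n_m b n m.
Proof.
  intros H. destruct (le_lt_dec n m) as [Hnm|Hnm].
  2:{ rewrite !sum_R_empty by exact Hnm. apply Rle_refl. }
  revert H. induction Hnm as [|m Hnm IH]; intros H.
  - rewrite !sum_n_n. apply H. lia.
  - rewrite !sum_R_S by lia. apply Rplus_le_compat.
    + apply IH. intros k Hk. apply H. lia.
    + apply H. lia.
Qed.

Lemma sqrt_INR_ge1 (k : nat) : (1 <= k)%nat -> 1 <= sqrt (INR k).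
Proof.
  intros H. apply (le_INR 1) in H. rewrite <- sqrt_1. apply sqrt_le_1_alt. exact H.
Qed.

Lemma sqrt_INR_S (k : nat) :
  sqrt (INR (S k)) * sqrt (INR (S k)) = sqrt (INR k) * sqrt (INR k) + 1.
Proof. rewrite !sqrt_sqrt by apply pos_INR. apply S_INR. Qed.

Lemma sum_inv_sqrt (k : nat) : sum_n_m (fun m => / sqrt (INR m)) 1 k <= 2 * sqrt (INR k).
Proof.
  induction k as [|k IH].
  - rewrite sum_R_empty by lia. simpl. rewrite sqrt_0. lra.
  - rewrite sum_R_S by lia.
    pose proof (sqrt_INR_ge1 (S k) ltac:(lia)) as H1. pose proof (sqrt_INR_S k) as H2.
    pose proof (sqrt_pos (INR k)) as H3.
    set (y := sqrt (INR (S k))) in *. set (x := sqrt (INR k)) in *.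
    enough (/ y <= 2 * y - 2 * x) by lra.
    rewrite <- Rdiv_1_l. apply Rle_div_l; nra.
Qed.

Lemma sum_inv_mul_sqrt (k : nat) : sum_n_m (fun m => / (INR m * sqrt (INR m))) 1 k <= 3.
Proof.
  destruct k as [|k]; [rewrite sum_R_empty by lia; lra|].
  (* The subtracted term lets the induction close: 1/y^3 <= 2/x - 2/y for consecutive square roots x
     < y, and 3 is the value with equality at one term. *)
  enough (sum_n_m (fun m => / (INR m * sqrt (INR m))) 1 (S k) <= 3 - 2 / sqrt (INR (S k))) as H.
  { assert (0 < 2 / sqrt (INR (S k))); [|lra].
    pose proof (sqrt_INR_ge1 (S k) ltac:(lia)). apply Rdiv_lt_0_compat; lra. }
  induction k as [|k IH].
  - rewrite sum_n_n. simpl. rewrite sqrt_1. lra.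
  - rewrite sum_R_S by lia.
    pose proof (sqrt_INR_ge1 (S k) ltac:(lia)) as H1. pose proof (sqrt_INR_S (S k)) as H2.
    pose proof (sqrt_INR_ge1 (S (S k)) ltac:(lia)) as H3.
    replace (INR (S (S k))) with (sqrt (INR (S (S k))) * sqrt (INR (S (S k)))) at 1
      by (apply sqrt_sqrt, pos_INR).
    set (y := sqrt (INR (S (S k)))) in *. set (x := sqrt (INR (S k))) in *.
    enough (/ (y * y * y) <= 2 / x - 2 / y) by lra.
    replace (2 / x - 2 / y) with (2 * (y - x) / (x * y)) by (field; lra).
    assert (Hxy : (y - x) * (y + x) = 1) by nra.
    assert (Hx : 0 < y - x) by nra.
    rewrite <- Rdiv_1_l. apply Rle_div_l; [apply Rmult_lt_0_compat; nra|].
    replace (2 * (y - x) / (x * y) * (y * y * y)) with (2 * (y - x) * (y * y) / x) by (field; lra).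
    apply Rle_div_r; [lra|]. nra.
Qed.

Lemma pow_tri_bound (k m : nat) : 0 <= 2 ^ tri k m <= 2.
Proof. unfold tri. destruct (Nat.eqb k m); simpl; lra. Qed.

Lemma Wsum_nonneg (s : list nat) (k m : nat) : (1 <= m)%nat -> 0 <= Wsum s k m.
Proof.
  intros Hm. revert k. induction s as [|a s IH]; intros k; simpl Wsum; [apply pow_tri_bound|].
  transitivity (sum_n_m (fun _ => 0 * 0) m k).
  { rewrite sum_R_mult_l. lra. }
  apply sum_R_le. intros l Hl. rewrite Rmult_0_l.
  apply Rmult_le_pos; [apply Rmult_le_pos|apply IH].
  - apply pow_tri_bound.
  - apply Rlt_le, Rinv_0_lt_compat, pow_lt, odd_r_pos. lia.
Qed.

(** Each level costs a factor 4: 2 from the power of two and 2 from [sum_inv_sqrt]. The inequality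
    sqrt l / (2l-1) <= 1 / sqrt l restores the same weight for the next level. *)
Lemma sum_Wsum_bound (e k : nat) :
  sum_n_m (fun m => Wsum (repeat 1%nat e) k m * / sqrt (INR m)) 1 k <= 4 ^ S e * sqrt (INR k).
Proof.
  revert k. induction e as [|e IH]; intros k.
  - transitivity (sum_n_m (fun m => 2 * / sqrt (INR m)) 1 k).
    + apply sum_R_le. intros m Hm. simpl Wsum. apply Rmult_le_compat_r; [|apply pow_tri_bound].
      pose proof (sqrt_INR_ge1 m ltac:(lia)). apply Rlt_le, Rinv_0_lt_compat. lra.
    + rewrite sum_R_mult_l. pose proof (sum_inv_sqrt k). simpl. lra.
  - transitivity (sum_n_m (fun m => sum_n_m (fun l => 2 ^ tri k l * / odd_r l ^ 1 *
        (Wsum (repeat 1%nat e) l m * / sqrt (INR m))) m k) 1 k).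
    { right. apply sum_R_ext. intros m _. simpl repeat. simpl Wsum.
      rewrite Rmult_comm, <- sum_R_mult_l. apply sum_R_ext. intros l _. rewrite pow_1, Rmult_1_r. ring. }
    rewrite <- (sum_n_m_triangle (fun l m => 2 ^ tri k l * / odd_r l ^ 1 *
        (Wsum (repeat 1%nat e) l m * / sqrt (INR m)))).
    transitivity (sum_n_m (fun l => 2 * 4 ^ S e * / sqrt (INR l)) 1 k).
    2:{ rewrite sum_R_mult_l. pose proof (sum_inv_sqrt k).
        assert (0 < 4 ^ S e) by (apply pow_lt; lra).
        change (4 ^ S (S e)) with (4 * 4 ^ S e). nra. }
    apply sum_R_le. intros l Hl. rewrite sum_R_mult_l, pow_1.
    pose proof (sqrt_INR_ge1 l ltac:(lia)) as Hs. destruct (odd_r_ge l ltac:(lia)) as [H1 H2].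
    assert (0 < 4 ^ S e) by (apply pow_lt; lra).
    transitivity (2 * / odd_r l * (4 ^ S e * sqrt (INR l))).
    { apply Rmult_le_compat; [| |apply Rmult_le_compat_r; [|apply pow_tri_bound]|apply IH].
      - apply Rmult_le_pos; [apply pow_tri_bound|]. apply Rlt_le, Rinv_0_lt_compat. lra.
      - transitivity (sum_n_m (fun _ => 0 * 0) 1 l).
        { rewrite sum_R_mult_l. lra. }
        apply sum_R_le. intros m Hm. rewrite Rmult_0_l.
        apply Rmult_le_pos; [apply Wsum_nonneg; lia|].
        pose proof (sqrt_INR_ge1 m ltac:(lia)). apply Rlt_le, Rinv_0_lt_compat. lra.
      - apply Rlt_le, Rinv_0_lt_compat. lra. }
    replace (2 * / odd_r l * (4 ^ S e * sqrt (INR l)))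
      with (2 * 4 ^ S e * (sqrt (INR l) * / odd_r l)) by ring.
    apply Rmult_le_compat_l; [lra|].
    apply Rle_div_l; [lra|].
    rewrite <- (sqrt_sqrt (INR l)) in H1 by lra.
    transitivity (/ sqrt (INR l) * (sqrt (INR l) * sqrt (INR l))).
    { right. field. lra. }
    apply Rmult_le_compat_l; [apply Rlt_le, Rinv_0_lt_compat; lra|exact H1].
Qed.

(** For c = 1 the entries have modulus 2^tri(k,m) / (2m-1), with no decay in the row index. For c >=
    3 a factor 1/(2k-1) remains in front, which turns the bound sqrt k of [sum_Wsum_bound] into 1 /
    sqrt k. *)
Lemma Mmat_growth (c : nat) : (1 <= c)%nat -> c <> 2%nat ->
  exists C, 0 <= C /\ forall k, (1 <= k)%nat ->
    sum_n_m (fun m => Rabs (Mmat c k m) * sqrt (INR m)) 1 k <= C * sqrt (INR k) /\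
    ((3 <= c)%nat ->
     sum_n_m (fun m => Rabs (Mmat c k m) * sqrt (INR m)) 1 k <= C / sqrt (INR k)).
Proof.
  intros Hc Hc2.
  assert (HM : forall k m, Mmat c k m = (-1) ^ (k * delta c) * odd_r k ^ delta c * / odd_r k ^ 2 *
       ((-1) ^ (m * delta c) * odd_r m ^ delta c * / odd_r m * Vsharp (ones c) k m)).
  { intros k m. unfold Mmat. apply Nat.eqb_neq in Hc2. rewrite Hc2. reflexivity. }
  assert (Hcc : c = 1%nat \/ exists e, c = S (S (S e))).
  { destruct c as [|[|[|e]]]; [lia|now left|lia|right; now exists e]. }
  destruct Hcc as [->|[e ->]].
  - exists 4. split; [lra|]. intros k Hk. split; [|lia].
    transitivity (sum_n_m (fun m => 2 * / sqrt (INR m)) 1 k).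
    2:{ rewrite sum_R_mult_l. pose proof (sum_inv_sqrt k). lra. }
    apply sum_R_le. intros m Hm. rewrite HM, Vsharp_Wsum by lia.
    simpl Wsum. simpl delta. rewrite !Nat.mul_1_r, !pow_1.
    replace ((-1) ^ k * odd_r k * / odd_r k ^ 2 *
      ((-1) ^ m * odd_r m * / odd_r m * (odd_r k / odd_r m * 2 ^ tri k m)))
      with ((-1) ^ k * (-1) ^ m * (2 ^ tri k m * / odd_r m)) by (field; split; apply odd_r_neq0).
    rewrite !Rabs_mult, !pow_1_abs, !Rmult_1_l.
    pose proof (sqrt_INR_ge1 m ltac:(lia)) as Hs. destruct (odd_r_ge m ltac:(lia)) as [H1 H2].
    pose proof (pow_tri_bound k m) as Ht.
    assert (Hi : 0 < / odd_r m) by (apply Rinv_0_lt_compat; lra).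
    rewrite !Rabs_pos_eq by lra. rewrite Rmult_assoc. apply Rmult_le_compat; try lra.
    { apply Rmult_le_pos; lra. }
    rewrite Rmult_comm. apply Rle_div_l; [lra|].
    rewrite <- (sqrt_sqrt (INR m)) in H1 by lra.
    transitivity (/ sqrt (INR m) * (sqrt (INR m) * sqrt (INR m))).
    { right. field. lra. }
    apply Rmult_le_compat_l; [apply Rlt_le, Rinv_0_lt_compat; lra|exact H1].
  - exists (4 ^ S e).
    assert (H4 : 0 < 4 ^ S e) by (apply pow_lt; lra).
    split; [lra|]. intros k Hk.
    pose proof (sqrt_INR_ge1 k Hk) as Hsk. destruct (odd_r_ge k Hk) as [Hk1 Hk2].
    enough (E : sum_n_m (fun m => Rabs (Mmat (S (S (S e))) k m) * sqrt (INR m)) 1 k <=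
      4 ^ S e / sqrt (INR k)).
    { split; [|intros _; exact E]. apply (Rle_trans _ _ _ E). unfold Rdiv.
      apply Rmult_le_compat_l; [lra|]. transitivity 1; [|exact Hsk].
      rewrite <- Rinv_1. apply Rinv_le_contravar; lra. }
    transitivity (/ INR k * sum_n_m (fun m => Wsum (repeat 1%nat e) k m * / sqrt (INR m)) 1 k).
    2:{ transitivity (/ INR k * (4 ^ S e * sqrt (INR k))).
        - apply Rmult_le_compat_l; [apply Rlt_le, Rinv_0_lt_compat; lra|apply sum_Wsum_bound].
        - right. rewrite <- (sqrt_sqrt (INR k)) at 1 by lra. field. lra. }
    rewrite <- sum_R_mult_l. apply sum_R_le. intros m Hm.
    rewrite HM, Vsharp_Wsum by lia. unfold ones. replace (S (S (S e)) - 3)%nat with e by lia.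
    simpl delta. rewrite !Nat.mul_0_r, !pow_O.
    pose proof (Wsum_nonneg (repeat 1%nat e) k m ltac:(lia)) as HW.
    pose proof (sqrt_INR_ge1 m ltac:(lia)) as Hs. destruct (odd_r_ge m ltac:(lia)) as [H1 H2].
    replace (1 * 1 * / odd_r k ^ 2 * (1 * 1 * / odd_r m * (odd_r k / odd_r m * Wsum (repeat 1%nat e) k m)))
      with (/ odd_r k * (Wsum (repeat 1%nat e) k m * (/ (odd_r m * odd_r m)))) by (field; lra).
    assert (Hi : 0 < / odd_r k) by (apply Rinv_0_lt_compat; lra).
    assert (Hj : 0 < / (odd_r m * odd_r m)) by (apply Rinv_0_lt_compat; nra).
    rewrite Rabs_pos_eq by (repeat apply Rmult_le_pos; lra).
    rewrite !Rmult_assoc. apply Rmult_le_compat; try lra.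
    { repeat apply Rmult_le_pos; lra. }
    { apply Rinv_le_contravar; lra. }
    apply Rmult_le_compat_l; [exact HW|].
    rewrite Rmult_comm. apply Rle_div_l; [nra|].
    assert (Hms : INR m = sqrt (INR m) * sqrt (INR m)) by (symmetry; apply sqrt_sqrt; lra).
    apply Rmult_le_reg_l with (sqrt (INR m)); [lra|].
    rewrite <- Rmult_assoc, Rinv_r, Rmult_1_l, <- Hms by lra. nra.
Qed.

(** * Convergence of complex sequences and Tannery's theorem *)

(** Convergence by components, so that limit arithmetic reduces to [is_lim_seq]; [Ccv_filterlim]
    translates it back for the theorem. *)
Definition Ccv (f : nat -> C) (l : C) : Prop :=
  is_lim_seq (fun n => Re (f n)) (Re l) /\ is_lim_seq (fun n => Im (f n)) (Im l).

Lemma Ccv_filterlim (f : nat -> C) (l : C) :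
  Ccv f l -> filterlim f eventually (locally l).
Proof.
  intros [H1 H2]. apply filterlim_locally. intros eps.
  generalize (filter_and _ _ (proj1 (filterlim_locally _ _) H1 eps)
                             (proj1 (filterlim_locally _ _) H2 eps)).
  apply filter_imp. intros n [Ha Hb]. split; assumption.
Qed.

Lemma Ccv_ext (f g : nat -> C) (l : C) : (forall n, f n = g n) -> Ccv f l -> Ccv g l.
Proof.
  intros H [H1 H2]. split; [revert H1|revert H2]; apply is_lim_seq_ext; intros n; now rewrite H.
Qed.

Lemma Ccv_ext_loc (f g : nat -> C) (l : C) :
  (forall n, (1 <= n)%nat -> f n = g n) -> Ccv f l -> Ccv g l.
Proof.
  intros H [H1 H2].
  split; [revert H1|revert H2]; apply is_lim_seq_ext_loc; exists 1%nat; intros n Hn; now rewrite H.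
Qed.

Lemma Ccv_const (x : C) : Ccv (fun _ => x) x.
Proof. split; apply is_lim_seq_const. Qed.

Lemma Ccv_RtoC (f : nat -> R) (l : R) : is_lim_seq f l -> Ccv (fun n => RtoC (f n)) (RtoC l).
Proof. intros H. split; [exact H|apply is_lim_seq_const]. Qed.

Lemma Ccv_plus (f g : nat -> C) (x y : C) :
  Ccv f x -> Ccv g y -> Ccv (fun n => (f n + g n)%C) (x + y)%C.
Proof. intros [H1 H2] [H3 H4]. split; simpl; apply is_lim_seq_plus'; assumption. Qed.

Lemma Ccv_mult (f g : nat -> C) (x y : C) :
  Ccv f x -> Ccv g y -> Ccv (fun n => (f n * g n)%C) (x * y)%C.
Proof.
  intros [H1 H2] [H3 H4].
  split; simpl; [apply is_lim_seq_minus'|apply is_lim_seq_plus']; apply is_lim_seq_mult'; assumption.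
Qed.

Lemma Ccv_sum (f : nat -> nat -> C) (g : nat -> C) (p q : nat) :
  (forall k, (p <= k <= q)%nat -> Ccv (fun n => f n k) (g k)) ->
  Ccv (fun n => sum_n_m (f n) p q) (sum_n_m g p q).
Proof.
  intros H. destruct (le_lt_dec p q) as [Hpq|Hpq].
  - revert H. induction Hpq as [|q Hpq IH]; intros H.
    + rewrite sum_n_n. apply Ccv_ext with (fun n => f n p); [|apply H; lia].
      intros n. rewrite sum_n_n. reflexivity.
    + rewrite sum_n_Sm by lia.
      apply Ccv_ext with (fun n => (sum_n_m (f n) p q + f n (S q))%C).
      { intros n. rewrite sum_n_Sm by lia. reflexivity. }
      apply Ccv_plus; [apply IH; intros k Hk|]; apply H; lia.
  - rewrite sum_n_m_zero by exact Hpq. apply Ccv_ext with (fun _ => zero); [|apply Ccv_const].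
    intros n. rewrite sum_n_m_zero by exact Hpq. reflexivity.
Qed.

Lemma Rabs_Im_le_Cmod (x : C) : Rabs (Im x) <= Cmod x.
Proof. apply Rle_trans with (2 := Rmax_Cmod x). apply Rmax_r. Qed.

Lemma Cmod_le_Re_Im (x : C) : Cmod x <= Rabs (Re x) + Rabs (Im x).
Proof.
  pose proof (Rabs_pos (Re x)) as H1. pose proof (Rabs_pos (Im x)) as H2.
  rewrite <- (Rabs_pos_eq (Cmod x)) by apply Cmod_ge_0.
  rewrite <- (Rabs_pos_eq (Rabs (Re x) + Rabs (Im x))) by lra.
  apply Rsqr_le_abs_0. rewrite !Rsqr_pow2, Cmod2_alt.
  rewrite <- (pow2_abs (Re x)), <- (pow2_abs (Im x)). nra.
Qed.

Lemma Ccv_of_Cmod (f : nat -> C) (l : C) :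
  (forall eps, 0 < eps -> exists N, forall n, (N <= n)%nat -> Cmod (f n - l) <= eps) -> Ccv f l.
Proof.
  intros H.
  split; apply is_lim_seq_spec; intros eps; destruct (H (pos (pos_div_2 eps)) (cond_pos _)) as [N HN];
    exists N; intros n Hn; specialize (HN n Hn);
    apply Rle_lt_trans with (Cmod (f n - l)).
  1: apply (re_le_Cmod (f n - l)).
  2: apply (Rabs_Im_le_Cmod (f n - l)).
  all: simpl in HN; pose proof (cond_pos eps); lra.
Qed.

Lemma Cmod_of_Ccv (f : nat -> C) (l : C) (eps : R) :
  Ccv f l -> 0 < eps -> exists N, forall n, (N <= n)%nat -> Cmod (f n - l) < eps.
Proof.
  intros [H1 H2] He. apply is_lim_seq_spec in H1. apply is_lim_seq_spec in H2.
  assert (He2 : 0 < eps / 2) by lra.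
  destruct (H1 (mkposreal _ He2)) as [N1 HN1]. destruct (H2 (mkposreal _ He2)) as [N2 HN2].
  exists (N1 + N2)%nat. intros n Hn.
  specialize (HN1 n ltac:(lia)). specialize (HN2 n ltac:(lia)). simpl in HN1, HN2.
  apply Rle_lt_trans with (1 := Cmod_le_Re_Im _).
  change (Re (f n - l)) with (Re (f n) - Re l). change (Im (f n - l)) with (Im (f n) - Im l). lra.
Qed.

Lemma Rabs_sum_le (a : nat -> R) (n m : nat) :
  Rabs (sum_n_m a n m) <= sum_n_m (fun k => Rabs (a k)) n m.
Proof. exact (norm_sum_n_m (V := R_NormedModule) a n m). Qed.

Lemma Cmod_sum_le (a : nat -> C) (n m : nat) :
  Cmod (sum_n_m a n m) <= sum_n_m (fun k => Cmod (a k)) n m.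
Proof. exact (norm_sum_n_m (V := C_NormedModule) a n m). Qed.

Lemma sum_incr_cv (a : nat -> R) (M : R) :
  (forall k, (1 <= k)%nat -> 0 <= a k) -> (forall p, sum_n_m a 1 p <= M) ->
  ex_finite_lim_seq (fun p => sum_n_m a 1 p).
Proof.
  intros Ha HM. apply ex_finite_lim_seq_incr with M; [|exact HM].
  intros n. rewrite sum_R_S by lia. specialize (Ha (S n) ltac:(lia)). lra.
Qed.

Lemma tannery_R (f : nat -> nat -> R) (g w : nat -> R) (M : R) :
  (forall n k, (1 <= k)%nat -> Rabs (f n k) <= w k) ->
  (forall k, (1 <= k)%nat -> is_lim_seq (fun n => f n k) (g k)) ->
  (forall p, sum_n_m w 1 p <= M) ->
  exists L : R, is_lim_seq (fun p => sum_n_m g 1 p) L /\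
    forall eps, 0 < eps -> exists N, forall n p, (N <= n)%nat -> (N <= p)%nat ->
    Rabs (sum_n_m (f n) 1 p - L) <= eps.
Proof.
  intros Hf Hg HM.
  assert (Hw : forall k, (1 <= k)%nat -> 0 <= w k).
  { intros k Hk. apply Rle_trans with (2 := Hf 0%nat k Hk). apply Rabs_pos. }
  assert (Hgw : forall k, (1 <= k)%nat -> Rabs (g k) <= w k).
  { intros k Hk.
    apply (is_lim_seq_le (fun n => Rabs (f n k)) (fun _ => w k) (Rabs (g k)) (w k)).
    - intros n. apply Hf, Hk.
    - apply (is_lim_seq_abs _ (g k)), Hg, Hk.
    - apply is_lim_seq_const. }
  destruct (sum_incr_cv w M Hw HM) as [W HW].
  assert (HL : exists L : R, is_lim_seq (fun p => sum_n_m g 1 p) L).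
  { destruct (sum_incr_cv (fun k => g k + w k) (2 * M)) as [L' HL'].
    - intros k Hk. specialize (Hgw k Hk). apply Rabs_le_between in Hgw. lra.
    - intros p. transitivity (sum_n_m (fun k => 2 * w k) 1 p).
      + apply sum_R_le. intros k Hk. specialize (Hgw k ltac:(lia)). apply Rabs_le_between in Hgw. lra.
      + rewrite sum_R_mult_l. specialize (HM p). lra.
    - exists (L' - W).
      apply is_lim_seq_ext with (fun p => sum_n_m (fun k => g k + w k) 1 p - sum_n_m w 1 p).
      { intros p. rewrite sum_R_plus. ring. }
      apply is_lim_seq_minus'; assumption. }
  destruct HL as [L HL]. exists L. split; [exact HL|]. intros eps He.
  (* The budget: eps/8 for the first K terms, twice eps/4 for the tail of w beyond K, and eps/8 for
     the distance from the partial sum of g to L. *)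
  assert (He8 : 0 < eps / 8) by lra.
  apply is_lim_seq_spec in HL. apply is_lim_seq_spec in HW.
  destruct (HL (mkposreal _ He8)) as [N1 HN1]. destruct (HW (mkposreal _ He8)) as [K HK].
  simpl in HN1, HK.
  assert (Hfin : is_lim_seq (fun n => sum_n_m (fun k => Rabs (f n k - g k)) 1 K) 0).
  { clear -Hg. induction K as [|K IH].
    - apply is_lim_seq_ext with (fun _ => 0); [|apply is_lim_seq_const].
      intros n. rewrite sum_R_empty by lia. reflexivity.
    - apply is_lim_seq_ext with (fun n => sum_n_m (fun k => Rabs (f n k - g k)) 1 K + Rabs (f n (S K) - g (S K))).
      { intros n. rewrite sum_R_S by lia. reflexivity. }
      replace (Finite 0) with (Finite (0 + Rabs (g (S K) - g (S K))))
        by (f_equal; rewrite Rminus_diag, Rabs_R0; ring).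
      apply is_lim_seq_plus'; [exact IH|].
      apply (is_lim_seq_abs _ (g (S K) - g (S K))).
      apply is_lim_seq_minus'; [apply Hg; lia|apply is_lim_seq_const]. }
  apply is_lim_seq_spec in Hfin. destruct (Hfin (mkposreal _ He8)) as [N2 HN2]. simpl in HN2.
  exists (N1 + N2 + K)%nat. intros n p Hn Hp.
  specialize (HN1 p ltac:(lia)). specialize (HN2 n ltac:(lia)).
  assert (Htail : sum_n_m w (S K) p <= eps / 4).
  { pose proof (HK p ltac:(lia)) as Hp1. pose proof (HK K ltac:(lia)) as Hp2.
    pose proof (sum_n_m_Chasles w 1 K p ltac:(lia) ltac:(lia)) as E.
    change (sum_n_m w 1 p = sum_n_m w 1 K + sum_n_m w (S K) p) in E.
    apply Rabs_lt_between in Hp1. apply Rabs_lt_between in Hp2. lra. }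
  assert (Hdiff : Rabs (sum_n_m (f n) 1 p - sum_n_m g 1 p) <= 5 / 8 * eps).
  { assert (E : sum_n_m (f n) 1 p - sum_n_m g 1 p = sum_n_m (fun k => f n k + -1 * g k) 1 p :> R).
    { rewrite sum_R_plus, sum_R_mult_l. change (sum_n_m (fun k => f n k) 1 p) with (sum_n_m (f n) 1 p).
      change (sum_n_m (fun k => g k) 1 p) with (sum_n_m g 1 p). ring. }
    rewrite E.
    apply Rle_trans with (1 := Rabs_sum_le _ _ _).
    rewrite (sum_n_m_Chasles _ 1 K p) by lia.
    change plus with Rplus.
    rewrite Rminus_0_r in HN2. apply Rabs_lt_between in HN2.
    replace (5 / 8 * eps) with (eps / 8 + 2 * (eps / 4)) by field.
    apply Rplus_le_compat.
    - apply Rle_trans with (2 := Rlt_le _ _ (proj2 HN2)). right. apply sum_R_ext.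
      intros k _. f_equal. ring.
    - transitivity (sum_n_m (fun k => 2 * w k) (S K) p).
      + apply sum_R_le. intros k Hk. specialize (Hf n k ltac:(lia)). specialize (Hgw k ltac:(lia)).
        apply Rle_trans with (1 := Rabs_triang _ _). rewrite Rabs_mult, (Rabs_left (-1)); lra.
      + rewrite sum_R_mult_l. lra. }
  replace (sum_n_m (f n) 1 p - L)
    with ((sum_n_m (f n) 1 p - sum_n_m g 1 p) + (sum_n_m g 1 p - L)) by ring.
  apply Rle_trans with (1 := Rabs_triang _ _). lra.
Qed.

Lemma Re_sum (f : nat -> C) (n m : nat) : Re (sum_n_m f n m) = sum_n_m (fun k => Re (f k)) n m.
Proof.
  destruct (le_lt_dec n m) as [H|H].
  - induction H as [|m H IH]; [now rewrite !sum_n_n|].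
    rewrite !sum_n_Sm by lia. rewrite <- IH. reflexivity.
  - rewrite !sum_n_m_zero by exact H. reflexivity.
Qed.

Lemma Im_sum (f : nat -> C) (n m : nat) : Im (sum_n_m f n m) = sum_n_m (fun k => Im (f k)) n m.
Proof.
  destruct (le_lt_dec n m) as [H|H].
  - induction H as [|m H IH]; [now rewrite !sum_n_n|].
    rewrite !sum_n_Sm by lia. rewrite <- IH. reflexivity.
  - rewrite !sum_n_m_zero by exact H. reflexivity.
Qed.

(* The truncation parameter p is independent of n, so p = n and p tending to infinity before n
   give the same limit. *)
Lemma tannery (f : nat -> nat -> C) (g : nat -> C) (w : nat -> R) (M : R) :
  (forall n k, (1 <= k)%nat -> Cmod (f n k) <= w k) ->
  (forall k, (1 <= k)%nat -> Ccv (fun n => f n k) (g k)) ->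
  (forall p, sum_n_m w 1 p <= M) ->
  exists L : C, Ccv (fun p => sum_n_m g 1 p) L /\
    forall eps, 0 < eps -> exists N, forall n p, (N <= n)%nat -> (N <= p)%nat ->
    Cmod (sum_n_m (f n) 1 p - L) <= eps.
Proof.
  intros Hf Hg HM.
  destruct (tannery_R (fun n k => Re (f n k)) (fun k => Re (g k)) w M) as [L1 [Hg1 HL1]].
  { intros n k Hk. apply Rle_trans with (2 := Hf n k Hk). apply re_le_Cmod. }
  { intros k Hk. apply Hg, Hk. }
  { exact HM. }
  destruct (tannery_R (fun n k => Im (f n k)) (fun k => Im (g k)) w M) as [L2 [Hg2 HL2]].
  { intros n k Hk. apply Rle_trans with (2 := Hf n k Hk). apply Rabs_Im_le_Cmod. }
  { intros k Hk. apply Hg, Hk. }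
  { exact HM. }
  exists (L1, L2). split.
  { split; [revert Hg1|revert Hg2]; apply is_lim_seq_ext; intros p; symmetry; [apply Re_sum|apply Im_sum]. }
  intros eps He.
  destruct (HL1 (eps / 2) ltac:(lra)) as [N1 HN1]. destruct (HL2 (eps / 2) ltac:(lra)) as [N2 HN2].
  exists (N1 + N2)%nat. intros n p Hn Hp.
  specialize (HN1 n p ltac:(lia) ltac:(lia)). specialize (HN2 n p ltac:(lia) ltac:(lia)).
  rewrite <- Re_sum in HN1. rewrite <- Im_sum in HN2.
  apply Rle_trans with (1 := Cmod_le_Re_Im _).
  change (Re (sum_n_m (f n) 1 p - (L1, L2))) with (Re (sum_n_m (f n) 1 p) - L1).
  change (Im (sum_n_m (f n) 1 p - (L1, L2))) with (Im (sum_n_m (f n) 1 p) - L2). lra.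
Qed.

(** * Chains of conjugated operators *)

Lemma sum_C_ext (a b : nat -> C) (n m : nat) :
  (forall k, (n <= k <= m)%nat -> a k = b k) -> sum_n_m a n m = sum_n_m b n m :> C.
Proof. exact (sum_n_m_ext_loc a b n m). Qed.

Lemma sum_C_S (a : nat -> C) (n m : nat) : (n <= S m)%nat ->
  sum_n_m a n (S m) = (sum_n_m a n m + a (S m))%C :> C.
Proof. exact (sum_n_Sm a n m). Qed.

Lemma sum_C_mult_l (x : C) (a : nat -> C) (n m : nat) :
  sum_n_m (fun k => (x * a k)%C) n m = (x * sum_n_m a n m)%C :> C.
Proof. exact (sum_n_m_mult_l (K := C_Ring) x a n m). Qed.

Lemma sum_C_mult_r (x : C) (a : nat -> C) (n m : nat) :
  sum_n_m (fun k => (a k * x)%C) n m = (sum_n_m a n m * x)%C :> C.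
Proof. exact (sum_n_m_mult_r (K := C_Ring) x a n m). Qed.

Lemma RtoC_sum (a : nat -> R) (n m : nat) :
  RtoC (sum_n_m a n m) = sum_n_m (fun k => RtoC (a k)) n m.
Proof.
  destruct (le_lt_dec n m) as [H|H].
  - induction H as [|m H IH]; [now rewrite !sum_n_n|].
    rewrite !sum_n_Sm by lia. rewrite <- IH. apply RtoC_plus.
  - rewrite !sum_n_m_zero by exact H. reflexivity.
Qed.

Lemma sum_n_m_exchange {G : AbelianMonoid} (f : nat -> nat -> G) (a b p q : nat) :
  sum_n_m (fun i => sum_n_m (f i) p q) a b = sum_n_m (fun j => sum_n_m (fun i => f i j) a b) p q.
Proof.
  destruct (le_lt_dec a b) as [H|H].
  - induction H as [|b H IH].
    + rewrite sum_n_n. apply sum_n_m_ext. intros j. now rewrite sum_n_n.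
    + rewrite sum_n_Sm, IH, <- sum_n_m_plus by lia.
      apply sum_n_m_ext. intros j. now rewrite sum_n_Sm by lia.
  - rewrite sum_n_m_zero by exact H. rewrite <- (sum_n_m_const_zero p q).
    apply sum_n_m_ext. intros j. now rewrite sum_n_m_zero.
Qed.

(** Entry k of diag(g_0) M_(c_1) diag(g_1) ... M_(c_d) g_d. The diagonal factors are left abstract
    because they are instantiated by single powers, by partial geometric sums and by their
    limits. *)
Fixpoint Theta (d : nat) (c : nat -> nat) (g : nat -> nat -> C) (k : nat) : C :=
  match d with
  | O => g 0%nat k
  | S d' => (g 0%nat k * sum_n_m (fun m => (RtoC (Mmat (c 1%nat) k m) *
              Theta d' (fun i => c (S i)) (fun i => g (S i)) m)%C) 1 k)%C
  end.

Lemma Theta_ext (d : nat) (c c' : nat -> nat) (g g' : nat -> nat -> C) (k : nat) :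
  (forall i, (1 <= i <= d)%nat -> c i = c' i) ->
  (forall i m, (i <= d)%nat -> (1 <= m)%nat -> g i m = g' i m) -> (1 <= k)%nat ->
  Theta d c g k = Theta d c' g' k.
Proof.
  revert c c' g g' k. induction d as [|d IH]; intros c c' g g' k Hc Hg Hk; simpl.
  - apply Hg; [lia|exact Hk].
  - rewrite (Hg 0%nat), (Hc 1%nat) by lia. f_equal. apply sum_C_ext. intros m Hm. f_equal.
    apply IH; [intros; apply Hc; lia|intros; apply Hg; lia|lia].
Qed.

Lemma Theta_cv (d : nat) (c : nat -> nat) (gN : nat -> nat -> nat -> C) (g : nat -> nat -> C) (k : nat) :
  (forall i m, (i <= d)%nat -> (1 <= m)%nat -> Ccv (fun N => gN N i m) (g i m)) -> (1 <= k)%nat ->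
  Ccv (fun N => Theta d c (gN N) k) (Theta d c g k).
Proof.
  revert c gN g k. induction d as [|d IH]; intros c gN g k Hg Hk; simpl.
  - apply Hg; [lia|exact Hk].
  - apply Ccv_mult; [apply Hg; lia|].
    apply (Ccv_sum (fun N m => (RtoC (Mmat (c 1%nat) k m) *
      Theta d (fun i => c (S i)) (fun i => gN N (S i)) m)%C)).
    intros m Hm. apply Ccv_mult; [apply Ccv_const|].
    apply (IH (fun i => c (S i)) (fun N i => gN N (S i)) (fun i => g (S i))); [|lia].
    intros i j Hi Hj. apply Hg; lia.
Qed.

(** The constant A is chosen before g, so the bounds are uniform in the truncation of the exponents,
    as Tannery's theorem requires. The head g_0 is left unestimated, so that its own decay can be
    used when u = 0. *)
Lemma Theta_bound (d : nat) (c : nat -> nat) (G : R) :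
  (forall i, (1 <= i <= d)%nat -> (1 <= c i)%nat /\ c i <> 2%nat) -> 0 <= G ->
  exists A, 0 <= A /\ forall g,
    (forall i m, (1 <= i <= d)%nat -> (1 <= m)%nat -> Cmod (g i m) <= G) ->
    forall k, (1 <= k)%nat ->
      Cmod (Theta d c g k) <= Cmod (g 0%nat k) * (A * sqrt (INR k)) /\
      ((1 <= d)%nat -> (3 <= c 1%nat)%nat ->
       Cmod (Theta d c g k) <= Cmod (g 0%nat k) * (A / sqrt (INR k))).
Proof.
  revert c. induction d as [|d IH]; intros c Hc HG.
  - exists 1. split; [lra|]. intros g Hg k Hk. split; [|lia]. simpl.
    pose proof (sqrt_INR_ge1 k Hk). pose proof (Cmod_ge_0 (g 0%nat k)). nra.
  - destruct (IH (fun i => c (S i))) as [A [HA H]]; [intros i Hi; apply Hc; lia|exact HG|].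
    destruct (Mmat_growth (c 1%nat)) as [M [HM Hgr]]; [apply Hc; lia|apply Hc; lia|].
    assert (HGA : 0 <= G * A) by (apply Rmult_le_pos; assumption).
    exists (G * A * M). split; [apply Rmult_le_pos; assumption|].
    intros g Hg k Hk. simpl Theta. rewrite Cmod_mult.
    assert (HS : Cmod (sum_n_m (fun m => (RtoC (Mmat (c 1%nat) k m) *
        Theta d (fun i => c (S i)) (fun i => g (S i)) m)%C) 1 k) <=
      G * A * sum_n_m (fun m => Rabs (Mmat (c 1%nat) k m) * sqrt (INR m)) 1 k).
    { apply Rle_trans with (1 := Cmod_sum_le _ _ _). rewrite <- sum_R_mult_l.
      apply sum_R_le. intros m Hm. rewrite Cmod_mult, Cmod_R.
      replace (G * A * (Rabs (Mmat (c 1%nat) k m) * sqrt (INR m)))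
        with (Rabs (Mmat (c 1%nat) k m) * (G * (A * sqrt (INR m)))) by ring.
      apply Rmult_le_compat_l; [apply Rabs_pos|].
      destruct (H (fun i => g (S i))) with (k := m) as [H1 _]; [|lia|].
      { intros i j Hi Hj. apply Hg; lia. }
      apply Rle_trans with (1 := H1). apply Rmult_le_compat_r.
      - apply Rmult_le_pos; [exact HA|apply sqrt_pos].
      - apply Hg; lia. }
    destruct (Hgr k Hk) as [Hg1 Hg2].
    split; [|intros _ H3; specialize (Hg2 H3)];
      (apply Rmult_le_compat_l; [apply Cmod_ge_0|]); apply Rle_trans with (1 := HS).
    + rewrite (Rmult_assoc (G * A) M). apply Rmult_le_compat_l; assumption.
    + unfold Rdiv. rewrite (Rmult_assoc (G * A) M). apply Rmult_le_compat_l; assumption.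
Qed.

(** * Blocks of twos and sums over boxes of exponents *)

Lemma lhs_index_cons (d : nat) (c : nat -> nat) (a0 : nat) (a : list nat) :
  lhs_index (S d) c (a0 :: a) = repeat 2%nat a0 ++ c 1%nat :: lhs_index d (fun i => c (S i)) a.
Proof.
  unfold lhs_index. simpl. f_equal. f_equal. f_equal.
  rewrite <- (seq_shift d 1), !flat_map_concat_map, map_map. reflexivity.
Qed.

Lemma phi_twos (a : nat) (s : list nat) (k : nat) : (1 <= k)%nat ->
  phi (repeat 2%nat a ++ s) k = (/ odd_r k ^ 2) ^ a * phi s k.
Proof.
  intros Hk. induction a as [|a IH]; [simpl; ring|].
  change (phi (repeat 2%nat (S a) ++ s) k)
    with (sum_n_m (fun m => Mmat 2 k m * phi (repeat 2%nat a ++ s) m) 1 k).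
  destruct k as [|k]; [lia|]. rewrite sum_R_S by lia.
  rewrite (sum_R_ext _ (fun m => 0 * 0) 1 k).
  - rewrite sum_R_mult_l, IH. unfold Mmat. rewrite Nat.eqb_refl, Nat.eqb_refl.
    change ((/ odd_r (S k) ^ 2) ^ S a) with (/ odd_r (S k) ^ 2 * (/ odd_r (S k) ^ 2) ^ a). ring.
  - intros m Hm. unfold Mmat. rewrite Nat.eqb_refl.
    replace (Nat.eqb (S k) m) with false; [ring|]. symmetry. apply Nat.eqb_neq. lia.
Qed.

Lemma phi_lhs_index_cons (d : nat) (c : nat -> nat) (a0 : nat) (a : list nat) (k : nat) : (1 <= k)%nat ->
  phi (lhs_index (S d) c (a0 :: a)) k = (/ odd_r k ^ 2) ^ a0 *
    sum_n_m (fun m => Mmat (c 1%nat) k m * phi (lhs_index d (fun i => c (S i)) a) m) 1 k.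
Proof. intros Hk. rewrite lhs_index_cons, phi_twos by exact Hk. reflexivity. Qed.

Lemma phi_lhs_index_O (c : nat -> nat) (a : list nat) (k : nat) : (1 <= k)%nat ->
  phi (lhs_index 0 c a) k = (/ odd_r k ^ 2) ^ nth 0 a 0%nat.
Proof. intros Hk. unfold lhs_index. simpl flat_map. rewrite phi_twos by exact Hk. simpl phi. ring. Qed.

Lemma Theta_phi (d : nat) (c : nat -> nat) (a : list nat) (k : nat) :
  length a = S d -> (1 <= k)%nat ->
  Theta d c (fun i m => RtoC ((/ odd_r m ^ 2) ^ nth i a 0%nat)) k = RtoC (phi (lhs_index d c a) k).
Proof.
  revert c a k. induction d as [|d IH]; intros c a k Ha Hk.
  - rewrite phi_lhs_index_O by exact Hk. reflexivity.
  - destruct a as [|a0 a]; [discriminate|]. injection Ha as Ha.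
    rewrite phi_lhs_index_cons, RtoC_mult, RtoC_sum by exact Hk. simpl Theta. f_equal.
    apply sum_C_ext. intros m Hm. rewrite RtoC_mult. f_equal. apply IH; [exact Ha|lia].
Qed.

Lemma boxsum_ext (n N : nat) (F G : list nat -> C) :
  (forall l, length l = n -> F l = G l) -> boxsum n N F = boxsum n N G.
Proof.
  revert F G. induction n as [|n IH]; intros F G H; simpl; [apply H; reflexivity|].
  apply sum_C_ext. intros a _. apply IH. intros l Hl. apply H. simpl. now rewrite Hl.
Qed.

Lemma boxsum_mult_l (n N : nat) (x : C) (F : list nat -> C) :
  boxsum n N (fun l => (x * F l)%C) = (x * boxsum n N F)%C.
Proof.
  revert F. induction n as [|n IH]; intros F; simpl; [reflexivity|].
  rewrite <- sum_C_mult_l. apply sum_C_ext. intros a _. apply (IH (fun l => F (a :: l))).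
Qed.

Lemma boxsum_sum (n N p q : nat) (F : nat -> list nat -> C) :
  boxsum n N (fun l => sum_n_m (fun m => F m l) p q) = sum_n_m (fun m => boxsum n N (F m)) p q.
Proof.
  revert F. induction n as [|n IH]; intros F; simpl; [reflexivity|].
  rewrite (sum_n_m_exchange (fun m a => boxsum n N (fun l => F m (a :: l))) p q 0 N).
  apply sum_C_ext. intros a _. apply (IH (fun m l => F m (a :: l))).
Qed.

Lemma boxsum_cv (n N : nat) (F : nat -> list nat -> C) (G : list nat -> C) :
  (forall l, length l = n -> Ccv (fun j => F j l) (G l)) ->
  Ccv (fun j => boxsum n N (F j)) (boxsum n N G).
Proof.
  revert F G. induction n as [|n IH]; intros F G H; simpl; [apply H; reflexivity|].
  apply (Ccv_sum (fun j a => boxsum n N (fun l => F j (a :: l)))). intros a _.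
  apply (IH (fun j l => F j (a :: l))). intros l Hl. apply H. simpl. now rewrite Hl.
Qed.

Lemma Cprod_seq_S (f : nat -> C) (n : nat) :
  Cprod (map f (seq 0 (S n))) = (f 0%nat * Cprod (map (fun i => f (S i)) (seq 0 n)))%C.
Proof. simpl. rewrite <- seq_shift, map_map. reflexivity. Qed.

Lemma Cprod_single (f : nat -> C) (x : C) (u n : nat) : (u < n)%nat ->
  Cprod (map (fun i => (f i * (if Nat.eqb i u then x else RtoC 1))%C) (seq 0 n)) =
  (x * Cprod (map f (seq 0 n)))%C.
Proof.
  revert f u. induction n as [|n IH]; intros f u Hu; [lia|].
  rewrite !Cprod_seq_S. destruct u as [|u]; simpl Nat.eqb.
  - rewrite (map_ext (fun i => (f (S i) * RtoC 1)%C) (fun i => f (S i))).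
    + ring.
    + intros i. ring.
  - rewrite (IH (fun i => f (S i)) u) by lia. ring.
Qed.

(** The exponent a_i occurs only in the diagonal factor at position i, since M_2 is diagonal. The
    sum over the box therefore distributes into the chain, one geometric sum per position. *)
Lemma boxsum_phi (d N : nat) (c : nat -> nat) (v : nat -> nat -> C) (k : nat) : (1 <= k)%nat ->
  boxsum (S d) N (fun a => (RtoC (phi (lhs_index d c a) k) *
    Cprod (map (fun i => v i (nth i a 0%nat)) (seq 0 (S d))))%C) =
  Theta d c (fun i m => sum_n_m (fun a => (v i a * RtoC ((/ odd_r m ^ 2) ^ a))%C) 0 N) k.
Proof.
  revert c v k. induction d as [|d IH]; intros c v k Hk.
  - simpl boxsum. simpl Theta. apply sum_C_ext. intros a _.
    rewrite phi_lhs_index_O by exact Hk. simpl. ring.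
  - change (sum_n_m (fun a0 => boxsum (S d) N (fun l =>
        (RtoC (phi (lhs_index (S d) c (a0 :: l)) k) *
         Cprod (map (fun i => v i (nth i (a0 :: l) 0%nat)) (seq 0 (S (S d)))))%C)) 0 N =
      (sum_n_m (fun a => (v 0%nat a * RtoC ((/ odd_r k ^ 2) ^ a))%C) 0 N *
       sum_n_m (fun m => (RtoC (Mmat (c 1%nat) k m) * Theta d (fun i => c (S i))
         (fun i m0 => sum_n_m (fun a => (v (S i) a * RtoC ((/ odd_r m0 ^ 2) ^ a))%C) 0 N) m)%C) 1 k)%C).
    rewrite <- sum_C_mult_r. apply sum_C_ext. intros a0 _.
    transitivity (boxsum (S d) N (fun l => ((v 0%nat a0 * RtoC ((/ odd_r k ^ 2) ^ a0)) *
      sum_n_m (fun m => RtoC (Mmat (c 1%nat) k m) *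
        (RtoC (phi (lhs_index d (fun i => c (S i)) l) m) *
         Cprod (map (fun i => v (S i) (nth i l 0%nat)) (seq 0 (S d))))) 1 k)%C)).
    + apply boxsum_ext. intros l _.
      rewrite phi_lhs_index_cons, RtoC_mult, RtoC_sum, (Cprod_seq_S _ (S d)) by exact Hk.
      change (nth 0 (a0 :: l) 0%nat) with a0.
      change (fun i => v (S i) (nth (S i) (a0 :: l) 0%nat)) with (fun i => v (S i) (nth i l 0%nat)).
      set (P := Cprod (map _ _)).
      rewrite (sum_C_ext (fun m => (RtoC (Mmat (c 1%nat) k m) *
        (RtoC (phi (lhs_index d (fun i => c (S i)) l) m) * P))%C)
        (fun m => (RtoC (Mmat (c 1%nat) k m * phi (lhs_index d (fun i => c (S i)) l) m) * P)%C))
        by (intros m _; rewrite RtoC_mult; ring).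
      rewrite sum_C_mult_r. ring.
    + rewrite boxsum_mult_l. f_equal.
      rewrite (boxsum_sum (S d) N 1 k (fun m l => (RtoC (Mmat (c 1%nat) k m) *
        (RtoC (phi (lhs_index d (fun i => c (S i)) l) m) *
         Cprod (map (fun i => v (S i) (nth i l 0%nat)) (seq 0 (S d)))))%C)).
      apply sum_C_ext. intros m Hm. rewrite boxsum_mult_l. f_equal.
      apply (IH (fun i => c (S i)) (fun i => v (S i)) m). lia.
Qed.

(** * Chain sums as products of conjugated matrices *)

Lemma chainsum_ext (n N : nat) (F G : list nat -> C) :
  (forall l, F l = G l) ->
  chainsum n N F = chainsum n N G.
Proof.
  revert N F G. induction n as [|n IH]; intros N F G H; simpl; [apply H|].
  apply sum_C_ext. intros a _. apply IH. intros l. apply H.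
Qed.

Lemma chainsum_mult_l (n N : nat) (x : C) (F : list nat -> C) :
  chainsum n N (fun l => (x * F l)%C) = (x * chainsum n N F)%C.
Proof.
  revert N F. induction n as [|n IH]; intros N F; simpl; [reflexivity|].
  rewrite <- sum_C_mult_l. apply sum_C_ext. intros a _. apply (IH a (fun l => F (a :: l))).
Qed.

(* [rhs_factor] without its denominator, for an arbitrary value p of k_(-1), so that a chain can
   be cut after its first element. *)
Definition chain_coef (c : nat -> nat) (p : nat) (ks : list nat) (i : nat) : R :=
  let ki := nth i ks 0%nat in
  let kprev := match i with O => p | S j => nth j ks 0%nat end in
  let di := (delta (c i) + delta (c (S i)))%nat in
  (-1) ^ (ki * di) * powerRZ (odd_r ki) (Z.of_nat di - 1) * Vsharp (ones (c i)) kprev ki.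

Lemma powerRZ_pred (x : R) (n : nat) : x <> 0 -> powerRZ x (Z.of_nat n - 1) = x ^ n * / x.
Proof.
  intros Hx. unfold Z.sub. rewrite powerRZ_add by exact Hx.
  rewrite <- pow_powerRZ. simpl. rewrite Rmult_1_r. reflexivity.
Qed.

(** The power (2k-1)^(delta_i - 1) splits into (2k-1)^(delta(c_i) - 1) from the column of M_(c_i),
    (2k-1)^(delta(c_(i+1)) - 2) from the row of M_(c_(i+1)), and (2k-1)^2, which joins y. At the end
    of the chain, delta(0) = 2 supplies exactly this square with sign +1. *)
Lemma chainsum_coef (d K p : nat) (c : nat -> nat) (y : nat -> nat -> C) :
  c (S d) = 0%nat -> (forall i, (1 <= i <= d)%nat -> c i <> 2%nat) ->
  chainsum (S d) K (fun ks => Cprod (map (fun i =>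
    (RtoC (chain_coef c p ks i) * y i (nth i ks 0%nat))%C) (seq 0 (S d)))) =
  sum_n_m (fun k => (RtoC ((-1) ^ (k * delta (c 0%nat)) * odd_r k ^ delta (c 0%nat) * / odd_r k *
                           Vsharp (ones (c 0%nat)) p k) *
    Theta d c (fun i m => RtoC (odd_r m ^ 2) * y i m) k)%C) 1 K.
Proof.
  revert c y K p. induction d as [|d IH]; intros c y K p H0 Hc.
  - simpl chainsum. apply sum_C_ext. intros k Hk.
    change (Theta 0 c (fun i m => (RtoC (odd_r m ^ 2) * y i m)%C) k) with (RtoC (odd_r k ^ 2) * y 0%nat k)%C.
    simpl map.
    unfold Cprod, fold_right, chain_coef. rewrite H0.
    change (nth 0 (k :: nil) 0%nat) with k.
    rewrite powerRZ_pred by apply odd_r_neq0. change (delta 0) with 2%nat.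
    rewrite Nat.mul_add_distr_l, !pow_add, (Nat.mul_comm k 2), pow_1_even.
    rewrite !RtoC_mult. ring.
  - change (sum_n_m (fun k => chainsum (S d) k (fun l => Cprod (map (fun i =>
        (RtoC (chain_coef c p (k :: l) i) * y i (nth i (k :: l) 0%nat))%C) (seq 0 (S (S d)))))) 1 K =
      sum_n_m (fun k => (RtoC ((-1) ^ (k * delta (c 0%nat)) * odd_r k ^ delta (c 0%nat) * / odd_r k *
                           Vsharp (ones (c 0%nat)) p k) *
        ((RtoC (odd_r k ^ 2) * y 0%nat k) * sum_n_m (fun m => (RtoC (Mmat (c 1%nat) k m) *
          Theta d (fun i => c (S i)) (fun i m => RtoC (odd_r m ^ 2) * y (S i) m) m)) 1 k))%C) 1 K :> C).
    apply sum_C_ext. intros k Hk.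
    transitivity (chainsum (S d) k (fun l =>
      ((RtoC ((-1) ^ (k * (delta (c 0%nat) + delta (c 1%nat))) *
          powerRZ (odd_r k) (Z.of_nat (delta (c 0%nat) + delta (c 1%nat)) - 1) *
          Vsharp (ones (c 0%nat)) p k) * y 0%nat k) *
       Cprod (map (fun i => (RtoC (chain_coef (fun i => c (S i)) k l i) * y (S i) (nth i l 0%nat)))
         (seq 0 (S d))))%C)).
    { apply chainsum_ext. intros l. rewrite (Cprod_seq_S _ (S d)). f_equal. }
    rewrite chainsum_mult_l, (IH (fun i => c (S i)) (fun i => y (S i)) k k).
    2:{ exact H0. }
    2:{ intros i Hi. apply Hc. lia. }
    rewrite powerRZ_pred by apply odd_r_neq0.
    rewrite Nat.mul_add_distr_l, !pow_add.
    transitivity ((RtoC ((-1) ^ (k * delta (c 0%nat)) * odd_r k ^ delta (c 0%nat) * / odd_r k *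
                           Vsharp (ones (c 0%nat)) p k) * y 0%nat k * RtoC (odd_r k ^ 2)) *
      (RtoC ((-1) ^ (k * delta (c 1%nat)) * odd_r k ^ delta (c 1%nat) * / odd_r k ^ 2) *
       sum_n_m (fun m => (RtoC ((-1) ^ (m * delta (c 1%nat)) * odd_r m ^ delta (c 1%nat) * / odd_r m *
                           Vsharp (ones (c 1%nat)) k m) *
          Theta d (fun i => c (S i)) (fun i m => RtoC (odd_r m ^ 2) * y (S i) m) m)) 1 k))%C.
    { set (S1 := sum_n_m _ _ _).
      assert (E : RtoC ((-1) ^ (k * delta (c 0%nat)) * (-1) ^ (k * delta (c 1%nat)) *
        (odd_r k ^ delta (c 0%nat) * odd_r k ^ delta (c 1%nat) * / odd_r k) * Vsharp (ones (c 0%nat)) p k) =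
        (RtoC ((-1) ^ (k * delta (c 0%nat)) * odd_r k ^ delta (c 0%nat) * / odd_r k *
                           Vsharp (ones (c 0%nat)) p k) * RtoC (odd_r k ^ 2) *
         RtoC ((-1) ^ (k * delta (c 1%nat)) * odd_r k ^ delta (c 1%nat) * / odd_r k ^ 2))%C).
      { rewrite <- !RtoC_mult. f_equal. field. apply odd_r_neq0. }
      rewrite E. ring. }
    rewrite <- sum_C_mult_l.
    match goal with |- (?a * ?b)%C = (?x * (?y * ?z))%C =>
      replace b with z; [ring|] end.
    apply sum_C_ext. intros m Hm. rewrite Cmult_assoc, <- RtoC_mult. f_equal. f_equal.
    unfold Mmat. replace (Nat.eqb (c 1%nat) 2) with false; [reflexivity|].
    symmetry. apply Nat.eqb_neq, Hc. lia.
Qed.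

(** If u = 0, the factor 1/k^2 in g_0 outweighs the growth sqrt k. If u >= 1, the hypothesis gives
    c_1 >= 3, and the decay comes from the first matrix. *)
Lemma Theta_decay (d u : nat) (c : nat -> nat) (G : R) :
  (u <= d)%nat ->
  (forall i, (1 <= i <= d)%nat -> (1 <= c i)%nat /\ c i <> 2%nat) ->
  ((1 <= u)%nat -> (3 <= c 1%nat)%nat) -> 0 <= G ->
  exists A, 0 <= A /\ forall g,
    (forall i m, (i <= d)%nat -> (1 <= m)%nat -> Cmod (g i m) <= G) ->
    (forall m, (1 <= m)%nat -> Cmod (g u m) <= G / INR m ^ 2) ->
    forall k, (1 <= k)%nat -> Cmod (Theta d c g k) <= A / sqrt (INR k).
Proof.
  intros Hud Hc Hc1 HG. destruct (Theta_bound d c G Hc HG) as [A [HA H]].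
  exists (G * A). split; [apply Rmult_le_pos; assumption|].
  intros g Hg Hgu k Hk.
  destruct (H g) with (k := k) as [H1 H2]; [intros; apply Hg; lia|exact Hk|].
  pose proof (sqrt_INR_ge1 k Hk) as Hs.
  destruct u as [|u].
  - apply Rle_trans with (1 := H1).
    assert (Hk1 : INR k = sqrt (INR k) * sqrt (INR k)) by (symmetry; apply sqrt_sqrt, pos_INR).
    transitivity (G / INR k ^ 2 * (A * sqrt (INR k))).
    { apply Rmult_le_compat_r; [apply Rmult_le_pos; lra|apply Hgu, Hk]. }
    rewrite Hk1 at 1. set (x := sqrt (INR k)) in *.
    replace (G / (x * x) ^ 2 * (A * x)) with (G * A * (/ x * / (x * x))) by (field; lra).
    unfold Rdiv. apply Rmult_le_compat_l; [apply Rmult_le_pos; assumption|].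
    rewrite <- (Rmult_1_r (/ x)) at 2. apply Rmult_le_compat_l.
    + apply Rlt_le, Rinv_0_lt_compat. lra.
    + rewrite <- Rinv_1. apply Rinv_le_contravar; nra.
  - apply Rle_trans with (1 := H2 ltac:(lia) (Hc1 ltac:(lia))).
    unfold Rdiv. rewrite Rmult_assoc. apply Rmult_le_compat_r.
    + apply Rmult_le_pos; [exact HA|]. apply Rlt_le, Rinv_0_lt_compat. lra.
    + apply Hg; lia.
Qed.

Lemma beta_bound (k : nat) : (1 <= k)%nat -> Rabs (beta k) <= 2 / INR k.
Proof.
  intros Hk.
  apply (is_lim_seq_le (fun n => Rabs (Bmat n k)) (fun _ => 2 / INR k) (Rabs (beta k)) (2 / INR k)).
  - intros n. apply Bmat_bound, Hk.
  - apply (is_lim_seq_abs _ (beta k)), is_lim_seq_Bmat.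
  - apply is_lim_seq_const.
Qed.

Lemma Cmod_mul_decay (x : R) (t : C) (A : R) (k : nat) : (1 <= k)%nat ->
  Rabs x <= 2 / INR k -> Cmod t <= A / sqrt (INR k) ->
  Cmod (RtoC x * t) <= 2 * A * / (INR k * sqrt (INR k)).
Proof.
  intros Hk Hx Ht. rewrite Cmod_mult, Cmod_R. pose proof (sqrt_INR_ge1 k Hk).
  pose proof (odd_r_ge k Hk).
  transitivity (2 / INR k * (A / sqrt (INR k))).
  - apply Rmult_le_compat; try assumption; [apply Rabs_pos|apply Cmod_ge_0].
  - right. field. lra.
Qed.

Lemma sum_decay (A : R) (p : nat) : 0 <= A ->
  sum_n_m (fun k => 2 * A * / (INR k * sqrt (INR k))) 1 p <= 2 * A * 3.
Proof.
  intros HA. rewrite sum_R_mult_l. apply Rmult_le_compat_l; [lra|apply sum_inv_mul_sqrt].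
Qed.

Lemma Ccv_unique (f : nat -> C) (x y : C) : Ccv f x -> Ccv f y -> x = y.
Proof.
  intros [H1 H2] [H3 H4].
  apply is_lim_seq_unique in H1, H2, H3, H4. rewrite H1 in H3. rewrite H2 in H4.
  injection H3 as H3. injection H4 as H4. destruct x, y. simpl in *. now subst.
Qed.

Lemma sum_Bmat_Theta_cv (A : R) (t : nat -> C) : 0 <= A ->
  (forall k, (1 <= k)%nat -> Cmod (t k) <= A / sqrt (INR k)) ->
  exists L : C, Ccv (fun p => sum_n_m (fun k => (RtoC (beta k) * t k)%C) 1 p) L /\
    Ccv (fun n => sum_n_m (fun k => (RtoC (Bmat n k) * t k)%C) 1 n) L.
Proof.
  intros HA Ht.
  destruct (tannery (fun n k => (RtoC (Bmat n k) * t k)%C) (fun k => (RtoC (beta k) * t k)%C)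
    (fun k => 2 * A * / (INR k * sqrt (INR k))) (2 * A * 3)) as [L [HL H]].
  - intros n k Hk. apply Cmod_mul_decay; [exact Hk|apply Bmat_bound, Hk|apply Ht, Hk].
  - intros k Hk. apply Ccv_mult; [apply Ccv_RtoC, is_lim_seq_Bmat|apply Ccv_const].
  - intros p. apply sum_decay, HA.
  - exists L. split; [exact HL|]. apply Ccv_of_Cmod. intros eps He.
    destruct (H eps He) as [N HN]. exists N. intros n Hn. apply HN; exact Hn.
Qed.

Lemma lhs_index_pos (d : nat) (c : nat -> nat) (a : list nat) :
  (forall i, (1 <= i <= d)%nat -> (1 <= c i)%nat) ->
  forall x, In x (lhs_index d c a) -> (1 <= x)%nat.
Proof.
  intros Hc x Hx. unfold lhs_index in Hx. apply in_app_or in Hx. destruct Hx as [Hx|Hx].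
  - apply repeat_spec in Hx. lia.
  - apply in_flat_map in Hx. destruct Hx as [i [Hi [Hx|Hx]]].
    + subst x. apply in_seq in Hi. apply Hc. lia.
    + apply repeat_spec in Hx. lia.
Qed.

Lemma inv_odd_sqr_bound (k : nat) : (1 <= k)%nat ->
  0 < / odd_r k ^ 2 /\ / odd_r k ^ 2 <= / INR k ^ 2 /\ / odd_r k ^ 2 <= 1.
Proof.
  intros Hk. destruct (odd_r_ge k Hk) as [H1 H2]. split; [|split].
  - apply Rinv_0_lt_compat, pow_lt. lra.
  - apply Rinv_le_contravar; [apply pow_lt; lra|apply pow_incr; lra].
  - rewrite <- Rinv_1. apply Rinv_le_contravar; [lra|nra].
Qed.

(** [tstar] is the real part of an extended limit, so finiteness has to be proved. The condition a_u
    >= 1 makes the index start with 2 or with c_1 >= 3, and the decay of its [Theta] form gives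
    convergence. *)
Lemma tstar_cv (d u : nat) (c : nat -> nat) (a : list nat) :
  (u <= d)%nat ->
  (forall i, (1 <= i <= d)%nat -> (1 <= c i)%nat /\ c i <> 2%nat) ->
  ((1 <= u)%nat -> (3 <= c 1%nat)%nat) ->
  length a = S d -> nth u a 0%nat <> 0%nat ->
  Ccv (fun n => RtoC (tstar_trunc (lhs_index d c a) n)) (RtoC (tstar (lhs_index d c a))).
Proof.
  intros Hud Hc Hc1 Ha Hau.
  destruct (Theta_decay d u c 1 Hud Hc Hc1 ltac:(lra)) as [A [HA H]].
  set (g := fun i m => RtoC ((/ odd_r m ^ 2) ^ nth i a 0%nat)).
  destruct (sum_Bmat_Theta_cv A (Theta d c g) HA) as [L [_ HL]].
  { apply H.
    - intros i m _ Hm. unfold g. destruct (inv_odd_sqr_bound m Hm) as [H1 [_ H2]].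
      rewrite Cmod_R, Rabs_pos_eq by (apply pow_le; lra).
      rewrite <- (pow1 (nth i a 0%nat)). apply pow_incr. lra.
    - intros m Hm. unfold g. destruct (inv_odd_sqr_bound m Hm) as [H1 [H2 H3]].
      rewrite Cmod_R, Rabs_pos_eq by (apply pow_le; lra).
      destruct (nth u a 0%nat) as [|b]; [lia|]. unfold Rdiv. rewrite Rmult_1_l.
      apply Rle_trans with (2 := H2).
      change ((/ odd_r m ^ 2) ^ S b) with (/ odd_r m ^ 2 * (/ odd_r m ^ 2) ^ b).
      rewrite <- (Rmult_1_r (/ odd_r m ^ 2)) at 3. apply Rmult_le_compat_l; [lra|].
      rewrite <- (pow1 b). apply pow_incr. lra. }
  assert (HT : Ccv (fun n => RtoC (tstar_trunc (lhs_index d c a) n)) L).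
  { revert HL. apply Ccv_ext_loc. intros n Hn.
    rewrite tstar_trunc_phi, RtoC_sum; [|apply lhs_index_pos; intros; now apply Hc|exact Hn].
    apply sum_C_ext. intros k Hk. rewrite RtoC_mult. f_equal. apply Theta_phi; [exact Ha|lia]. }
  replace (RtoC (tstar (lhs_index d c a))) with L; [exact HT|].
  destruct HT as [H1 H2]. simpl in H1, H2.
  unfold tstar. rewrite (is_lim_seq_unique (tstar_trunc (lhs_index d c a)) _ H1).
  apply is_lim_seq_unique in H2. rewrite Lim_seq_const in H2. injection H2 as H2.
  destruct L as [x y]. simpl in *. now subst y.
Qed.

(** * The geometric series in each block *)

(** The restriction a_u >= 1 becomes a zero weight, so that the sum runs over a full box and factors
    position by position. *)
Definition weight (u : nat) (z : nat -> C) (i a : nat) : C :=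
  (pow_n (z i) (2 * a) *
   (if Nat.eqb i u then (if Nat.eqb a 0 then RtoC 0 else RtoC 1) else RtoC 1))%C.

Definition ratio (z : nat -> C) (i k : nat) : C := (z i * z i * RtoC (/ odd_r k ^ 2))%C.

Definition first (u : nat) (z : nat -> C) (i k : nat) : C :=
  if Nat.eqb i u then ratio z i k else RtoC 1.

Definition geoN (u : nat) (z : nat -> C) (N i k : nat) : C :=
  sum_n_m (fun a => (weight u z i a * RtoC ((/ odd_r k ^ 2) ^ a))%C) 0 N.

Definition geo (u : nat) (z : nat -> C) (i k : nat) : C :=
  (first u z i k / (1 - ratio z i k))%C.

Lemma weight_ratio (u : nat) (z : nat -> C) (i k a : nat) :
  (weight u z i a * RtoC ((/ odd_r k ^ 2) ^ a))%C =
  (ratio z i k ^ a *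
   (if Nat.eqb i u then (if Nat.eqb a 0 then RtoC 0 else RtoC 1) else RtoC 1))%C.
Proof.
  assert (E : (pow_n (z i) (2 * a) * RtoC ((/ odd_r k ^ 2) ^ a))%C = (ratio z i k ^ a)%C).
  { induction a as [|a IH].
    - apply Cmult_1_l.
    - replace (2 * S a)%nat with (S (S (2 * a))) by lia.
      change (pow_n (z i) (S (S (2 * a)))) with (z i * (z i * pow_n (z i) (2 * a)))%C.
      change ((/ odd_r k ^ 2) ^ S a) with (/ odd_r k ^ 2 * (/ odd_r k ^ 2) ^ a).
      rewrite RtoC_mult, Cpow_S, <- IH. unfold ratio. ring. }
  rewrite <- E. unfold weight. ring.
Qed.

Lemma geoN_partial (u : nat) (z : nat -> C) (N i k : nat) :
  ((1 - ratio z i k) * geoN u z N i k)%C = (first u z i k - ratio z i k ^ S N)%C.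
Proof.
  unfold geoN, first. induction N as [|N IH].
  - rewrite sum_n_n, weight_ratio. simpl. destruct (Nat.eqb i u); ring.
  - rewrite sum_C_S by lia. rewrite Cmult_plus_distr_l, IH, weight_ratio.
    simpl Nat.eqb. rewrite !Cpow_S. destruct (Nat.eqb i u); ring.
Qed.

Lemma ratio_bound (z : nat -> C) (i k : nat) (r : R) : (1 <= k)%nat -> r < 1 -> Cmod (z i) <= r ->
  Cmod (ratio z i k) <= r /\ Cmod (ratio z i k) <= / INR k ^ 2.
Proof.
  intros Hk Hr Hz. unfold ratio. rewrite !Cmod_mult, Cmod_R.
  destruct (inv_odd_sqr_bound k Hk) as [H1 [H2 H3]]. rewrite Rabs_pos_eq by lra.
  pose proof (Cmod_ge_0 (z i)) as H0.
  assert (H4 : 0 <= Cmod (z i) * Cmod (z i) <= r) by nra.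
  split; nra.
Qed.

Lemma one_minus_ratio (z : nat -> C) (i k : nat) (r : R) : (1 <= k)%nat -> r < 1 -> Cmod (z i) <= r ->
  1 - r <= Cmod (1 - ratio z i k) /\ (1 - ratio z i k)%C <> RtoC 0.
Proof.
  intros Hk Hr Hz. destruct (ratio_bound z i k r Hk Hr Hz) as [H _].
  assert (H1 : 1 - r <= Cmod (1 - ratio z i k)).
  { pose proof (Cmod_triangle (1 - ratio z i k) (ratio z i k)) as Ht.
    replace (1 - ratio z i k + ratio z i k)%C with (RtoC 1) in Ht by ring.
    rewrite Cmod_1 in Ht. lra. }
  split; [exact H1|]. intros E. rewrite E, Cmod_0 in H1. lra.
Qed.

(** The closed form bounds (1-r) times the partial sum by |first| + |ratio|, uniformly in N. Both
    terms are at most 1 in general; at i = u both are at most 1/k^2, because the series there starts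
    with the ratio itself. *)
Lemma geoN_bound (u : nat) (z : nat -> C) (N i k : nat) (r : R) :
  (1 <= k)%nat -> r < 1 -> Cmod (z i) <= r ->
  Cmod (geoN u z N i k) <= 2 / (1 - r) /\
  (i = u -> Cmod (geoN u z N i k) <= 2 / (1 - r) / INR k ^ 2).
Proof.
  intros Hk Hr Hz. destruct (ratio_bound z i k r Hk Hr Hz) as [Hq1 Hq2].
  destruct (one_minus_ratio z i k r Hk Hr Hz) as [H1 H2].
  pose proof (f_equal Cmod (geoN_partial u z N i k)) as E. rewrite Cmod_mult in E.
  pose proof (Cmod_ge_0 (geoN u z N i k)) as H0. pose proof (Cmod_ge_0 (ratio z i k)) as Hq0.
  assert (H3 : Cmod (first u z i k - ratio z i k ^ S N) <= Cmod (first u z i k) + Cmod (ratio z i k)).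
  { unfold Cminus. apply Rle_trans with (1 := Cmod_triangle _ _). apply Rplus_le_compat_l.
    rewrite Cmod_opp, Cmod_pow. change (Cmod (ratio z i k) ^ S N) with (Cmod (ratio z i k) * Cmod (ratio z i k) ^ N).
    rewrite <- (Rmult_1_r (Cmod (ratio z i k))) at 3. apply Rmult_le_compat_l; [exact Hq0|].
    rewrite <- (pow1 N). apply pow_incr. lra. }
  assert (H4 : (1 - r) * Cmod (geoN u z N i k) <= Cmod (first u z i k) + Cmod (ratio z i k)).
  { rewrite <- E in H3. apply Rle_trans with (2 := H3). apply Rmult_le_compat_r; assumption. }
  assert (Hr1 : 0 < 1 - r) by lra.
  split.
  - apply Rle_div_r; [exact Hr1|]. rewrite Rmult_comm.
    assert (Cmod (first u z i k) <= 1).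
    { unfold first. destruct (Nat.eqb i u); [lra|rewrite Cmod_1; lra]. }
    lra.
  - intros ->. unfold first in H4. rewrite Nat.eqb_refl in H4.
    replace (2 / (1 - r) / INR k ^ 2) with (2 * / INR k ^ 2 / (1 - r)).
    + apply Rle_div_r; [exact Hr1|]. rewrite Rmult_comm. lra.
    + field. pose proof (odd_r_ge k Hk). lra.
Qed.

Lemma geoN_cv (u : nat) (z : nat -> C) (i k : nat) (r : R) :
  (1 <= k)%nat -> r < 1 -> Cmod (z i) <= r -> Ccv (fun N => geoN u z N i k) (geo u z i k).
Proof.
  intros Hk Hr Hz. destruct (one_minus_ratio z i k r Hk Hr Hz) as [_ H2].
  destruct (ratio_bound z i k r Hk Hr Hz) as [Hq _].
  apply Ccv_ext with (fun N => (first u z i k + - (1) * ratio z i k ^ S N) * / (1 - ratio z i k))%C.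
  { intros N. replace (geoN u z N i k)
      with ((1 - ratio z i k) * geoN u z N i k * / (1 - ratio z i k))%C by (field; exact H2).
    rewrite geoN_partial. f_equal. ring. }
  replace (geo u z i k) with ((first u z i k + - (1) * 0) * / (1 - ratio z i k))%C
    by (unfold geo, Cdiv; ring).
  apply Ccv_mult; [|apply Ccv_const]. apply Ccv_plus; [apply Ccv_const|].
  apply Ccv_mult; [apply Ccv_const|].
  assert (Hg : is_lim_seq (fun n => Cmod (ratio z i k) ^ n) 0).
  { apply is_lim_seq_geom. rewrite Rabs_pos_eq by apply Cmod_ge_0. lra. }
  apply is_lim_seq_incr_1 in Hg. apply is_lim_seq_spec in Hg.
  apply Ccv_of_Cmod. intros eps He. destruct (Hg (mkposreal _ He)) as [N HN]. exists N. intros n Hn.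
  specialize (HN n Hn). simpl pos in HN. rewrite Rminus_0_r in HN.
  replace (ratio z i k ^ S n - 0)%C with (ratio z i k ^ S n)%C by ring.
  rewrite Cmod_pow. apply Rabs_lt_between in HN. lra.
Qed.

Lemma radius_bound (d : nat) (z : nat -> C) :
  (forall j, (j <= d)%nat -> Cmod (z j) < 1) ->
  exists r, r < 1 /\ forall j, (j <= d)%nat -> Cmod (z j) <= r.
Proof.
  induction d as [|d IH]; intros Hz.
  - exists (Cmod (z 0%nat)). split; [apply Hz; lia|]. intros j Hj. replace j with 0%nat by lia. lra.
  - destruct IH as [r [Hr H]]; [intros; apply Hz; lia|].
    exists (Rmax r (Cmod (z (S d)))). split.
    + apply Rmax_lub_lt; [exact Hr|apply Hz; lia].
    + intros j Hj. destruct (Nat.eq_dec j (S d)) as [->|Hne]; [apply Rmax_r|].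
      apply Rle_trans with (2 := Rmax_l _ _). apply H. lia.
Qed.

(** * Both truncated sides in the eigenbasis *)

Lemma Cprod_weight (d u : nat) (z : nat -> C) (a : list nat) : (u <= d)%nat ->
  Cprod (map (fun i => weight u z i (nth i a 0%nat)) (seq 0 (S d))) =
  ((if Nat.eqb (nth u a 0%nat) 0 then RtoC 0 else RtoC 1) *
   Cprod (map (fun i => pow_n (z i) (2 * nth i a 0%nat)) (seq 0 (S d))))%C.
Proof.
  intros Hu. rewrite <- (Cprod_single _ _ u) by lia. f_equal. apply map_ext. intros i.
  unfold weight. destruct (Nat.eqb_spec i u) as [->|]; reflexivity.
Qed.

Lemma lhs_trunc_weight (d u : nat) (c : nat -> nat) (z : nat -> C) (N : nat) : (u <= d)%nat ->
  lhs_trunc d u c z N = boxsum (S d) N (fun a => (RtoC (tstar (lhs_index d c a)) *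
    Cprod (map (fun i => weight u z i (nth i a 0%nat)) (seq 0 (S d))))%C).
Proof.
  intros Hu. unfold lhs_trunc. apply boxsum_ext. intros a _. rewrite Cprod_weight by exact Hu.
  destruct (Nat.eqb (nth u a 0%nat) 0); ring.
Qed.

Lemma lhs_trunc_cv (d u : nat) (c : nat -> nat) (z : nat -> C) (N : nat) :
  (u <= d)%nat ->
  (forall i, (1 <= i <= d)%nat -> (1 <= c i)%nat /\ c i <> 2%nat) ->
  ((1 <= u)%nat -> (3 <= c 1%nat)%nat) ->
  Ccv (fun n => sum_n_m (fun k => (RtoC (Bmat n k) * Theta d c (geoN u z N) k)%C) 1 n)
      (lhs_trunc d u c z N).
Proof.
  intros Hud Hc Hc1. rewrite lhs_trunc_weight by exact Hud.
  apply Ccv_ext_loc with (fun n => boxsum (S d) N (fun a =>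
    (RtoC (tstar_trunc (lhs_index d c a) n) *
     Cprod (map (fun i => weight u z i (nth i a 0%nat)) (seq 0 (S d))))%C)).
  - intros n Hn.
    transitivity (boxsum (S d) N (fun a => sum_n_m (fun k => RtoC (Bmat n k) *
      (RtoC (phi (lhs_index d c a) k) *
       Cprod (map (fun i => weight u z i (nth i a 0%nat)) (seq 0 (S d))))) 1 n)%C).
    + apply boxsum_ext. intros a _.
      rewrite tstar_trunc_phi, RtoC_sum; [|apply lhs_index_pos; intros; now apply Hc|exact Hn].
      rewrite <- sum_C_mult_r. apply sum_C_ext. intros k _. rewrite RtoC_mult. ring.
    + rewrite (boxsum_sum (S d) N 1 n (fun k a => (RtoC (Bmat n k) *
        (RtoC (phi (lhs_index d c a) k) *
         Cprod (map (fun i => weight u z i (nth i a 0%nat)) (seq 0 (S d)))))%C)).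
      apply sum_C_ext. intros k Hk. rewrite boxsum_mult_l. f_equal. apply boxsum_phi. lia.
  - apply (boxsum_cv (S d) N (fun n a => (RtoC (tstar_trunc (lhs_index d c a) n) *
     Cprod (map (fun i => weight u z i (nth i a 0%nat)) (seq 0 (S d))))%C)).
    (* For a_u = 0 the truncated star sums may diverge, but the weight is 0 and both sides vanish
       identically. *)
    intros a Ha. destruct (Nat.eq_dec (nth u a 0%nat) 0) as [E|E].
    + rewrite Cprod_weight, E by exact Hud. simpl Nat.eqb. cbv iota.
      rewrite Cmult_0_l, Cmult_0_r. apply Ccv_ext with (fun _ => RtoC 0); [|apply Ccv_const].
      intros n. ring.
    + apply Ccv_mult; [|apply Ccv_const]. apply tstar_cv with u; assumption.
Qed.

Lemma rhs_trunc_Theta (d u : nat) (c : nat -> nat) (z : nat -> C) (N : nat) (r : R) :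
  (u <= d)%nat ->
  (forall i, (1 <= i <= d)%nat -> (1 <= c i)%nat /\ c i <> 2%nat) ->
  r < 1 -> (forall j, (j <= d)%nat -> Cmod (z j) <= r) ->
  rhs_trunc d u c z N = sum_n_m (fun k => (RtoC (beta k) * Theta d c (geo u z) k)%C) 1 N.
Proof.
  intros Hud Hc Hr Hz. unfold rhs_trunc.
  (* The prefactor z_u^2 / (2k_u-1)^2 is the ratio at position u; it is moved into the product there
     and becomes the leading term of a geometric series starting at a_u = 1. *)
  set (y := fun i k => ((if Nat.eqb i u then ratio z i k else RtoC 1) /
                        (RtoC (odd_r k ^ 2) - z i * z i))%C).
  rewrite <- chainsum_mult_l.
  transitivity (chainsum (S d) N (fun ks => (RtoC (2 / PI) * Cprod (map (fun i =>
    (RtoC (chain_coef (cext d c) 0 ks i) * y i (nth i ks 0%nat))) (seq 0 (S d))))%C)).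
  { apply chainsum_ext. intros ks.
    transitivity (RtoC (2 / PI) * (ratio z u (nth u ks 0%nat) *
      Cprod (map (rhs_factor d c z ks) (seq 0 (S d)))))%C; [unfold ratio; ring|].
    f_equal. rewrite <- (Cprod_single _ _ u) by lia. f_equal. apply map_ext. intros i.
    unfold y, rhs_factor, chain_coef, Cdiv.
    destruct (Nat.eqb_spec i u) as [->|]; ring. }
  rewrite chainsum_mult_l, (chainsum_coef d N 0 (cext d c) y).
  2:{ unfold cext. simpl. now rewrite Nat.eqb_refl. }
  2:{ intros i Hi. unfold cext. destruct (Nat.eqb_spec i 0); [lia|].
      destruct (Nat.eqb_spec i (S d)); [lia|]. apply Hc, Hi. }
  rewrite <- sum_C_mult_l. apply sum_C_ext. intros k Hk.
  rewrite Cmult_assoc, <- RtoC_mult. f_equal.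
  (* With k_(-1) = 0, [odd_r 0] is -1, so V# equals -2/(2k-1). The sign (-1)^k from c_0 = 1 and the
     prefactor 2/PI complete it to [beta k]. *)
  - f_equal. change (cext d c 0) with 1%nat. change (delta 1) with 1%nat.
    change (ones 1) with (@nil nat). unfold Vsharp, tri, beta.
    replace (Nat.eqb 0 k) with false by (symmetry; apply Nat.eqb_neq; lia).
    replace (odd_r 0) with (-1) by (unfold odd_r; simpl; ring).
    rewrite Nat.mul_1_r, !pow_1. change ((-1) ^ S k) with (-1 * (-1) ^ k). field.
    split; [apply PI_neq0|apply odd_r_neq0].
  - apply Theta_ext; [| |lia].
    + intros i Hi. unfold cext. destruct (Nat.eqb_spec i 0); [lia|].
      destruct (Nat.eqb_spec i (S d)); [lia|reflexivity].
    + intros i m Hi Hm. unfold y, geo. fold (first u z i m).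
      destruct (one_minus_ratio z i m r Hm Hr (Hz i Hi)) as [_ H1].
      assert (HD : RtoC (odd_r m ^ 2) <> RtoC 0).
      { intros E. apply RtoC_inj in E. apply (pow_nonzero (odd_r m) 2) in E; [exact E|apply odd_r_neq0]. }
      assert (E : (RtoC (odd_r m ^ 2) - z i * z i)%C = (RtoC (odd_r m ^ 2) * (1 - ratio z i m))%C).
      { unfold ratio. rewrite RtoC_inv by (apply pow_nonzero, odd_r_neq0). field. exact HD. }
      rewrite E. field. split; assumption.
Qed.

Theorem theorem3p4 (d u : nat) (c : nat -> nat) (z : nat -> C)
  (Hud : (u <= d)%nat)
  (Hc : forall i, (1 <= i <= d)%nat -> (1 <= c i)%nat /\ c i <> 2%nat)
  (Hc1 : (1 <= u)%nat -> (3 <= c 1%nat)%nat)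
  (Hz : forall j, (j <= d)%nat -> Cmod (z j) < 1) :
  exists L : C,
    filterlim (lhs_trunc d u c z) eventually (locally L) /\
    filterlim (rhs_trunc d u c z) eventually (locally L).
Proof.
  destruct (radius_bound d z Hz) as [r [Hr Hzr]].
  assert (HG : 0 <= 2 / (1 - r)) by (apply Rlt_le, Rdiv_lt_0_compat; lra).
  destruct (Theta_decay d u c (2 / (1 - r)) Hud Hc Hc1 HG) as [A [HA H]].
  assert (HT : forall N k, (1 <= k)%nat -> Cmod (Theta d c (geoN u z N) k) <= A / sqrt (INR k)).
  { intros N. apply H.
    - intros i m Hi Hm. apply (geoN_bound u z N i m r Hm Hr (Hzr i Hi)).
    - intros m Hm. now apply (geoN_bound u z N u m r Hm Hr (Hzr u Hud)). }
  destruct (tannery (fun N k => (RtoC (beta k) * Theta d c (geoN u z N) k)%C)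
    (fun k => (RtoC (beta k) * Theta d c (geo u z) k)%C)
    (fun k => 2 * A * / (INR k * sqrt (INR k))) (2 * A * 3)) as [L [HL HN]].
  { intros N k Hk. apply Cmod_mul_decay; [exact Hk|apply beta_bound, Hk|apply HT, Hk]. }
  { intros k Hk. apply Ccv_mult; [apply Ccv_const|]. apply Theta_cv; [|exact Hk].
    intros i m Hi Hm. apply (geoN_cv u z i m r Hm Hr (Hzr i Hi)). }
  { intros p. apply sum_decay, HA. }
  exists L. split; apply Ccv_filterlim.
  - apply Ccv_of_Cmod. intros eps He.
    destruct (HN (eps / 2) ltac:(lra)) as [N0 H0]. exists N0. intros N HN0.
    (* For fixed N, the limit in n is [lhs_trunc] at N, and it equals the limit in p of the sums
       with [beta]. Choosing p large depending on N, while N0 does not depend on p, places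
       [lhs_trunc] within eps of L. *)
    destruct (sum_Bmat_Theta_cv A (Theta d c (geoN u z N)) HA (HT N)) as [L' [HL1 HL2]].
    rewrite (Ccv_unique _ _ _ HL2 (lhs_trunc_cv d u c z N Hud Hc Hc1)) in HL1.
    destruct (Cmod_of_Ccv _ _ (eps / 2) HL1 ltac:(lra)) as [p0 Hp0].
    specialize (Hp0 (p0 + N0)%nat ltac:(lia)). specialize (H0 N (p0 + N0)%nat HN0 ltac:(lia)).
    set (S1 := sum_n_m _ _ _) in *.
    replace (lhs_trunc d u c z N - L)%C with (- (S1 - lhs_trunc d u c z N) + (S1 - L))%C by ring.
    apply Rle_trans with (1 := Cmod_triangle _ _). rewrite Cmod_opp. lra.
  - revert HL. apply Ccv_ext. intros N. symmetry. apply (rhs_trunc_Theta d u c z N r); assumption.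
Qed.
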